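(* Assume the Minimum-Witness 3-Product hypothesis. Then any algorithm computing incremental {\rm nw-SSSP}, and likewise decremental {\rm nw-SSSP}, on $n$-node undirected graphs requires $n^{3.5-o(1)}$ total update and query time.
   Context: {\rm nw-SSSP}: given a graph with nonnegative node weights and a fixed source $s$, maintain for every node $v$ the minimum over $s$–$v$ paths of the sum of node weights on the path (answering distance queries); incremental means only edge insertions, decremental only edge deletions. Minimum-Witness 3-Product: given three $n\times n$ Boolean matrices $A,B,C$, compute for every $(i_1,i_2,i_3)\in[n]^3$ the minimum $j\in[n]$ with $A_{i_1,j}\wedge B_{i_2,j}\wedge C_{i_3,j}$ (or report none exists). Minimum-Witness 3-Product hypothesis: there is no $O(n^{3.5-\varepsilon})$-time algorithm for this problem for any $\varepsilon>0$. *)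

(* Defs.v *)
From HB Require Import structures.
From mathcomp Require Import all_boot all_order all_algebra.
From mathcomp Require Import reals exp.
Set Implicit Arguments.
Unset Strict Implicit.
Unset Printing Implicit Defensive.
Import Order.TTheory GRing.Theory Num.Theory.

(* The machine is a word RAM whose memory consists of zero-initialised banks,  *)
(* cell [i] of bank [a] being [m a i].  A program names banks statically, so    *)
(* it uses finitely many of them; scalar variables are cells with a constant    *)
(* index.  Words of O(log n) bits are modelled by a bound [W], polynomial in n: *)
(* a run in which a value or an address exceeds [W] is stuck.                   *)
Definition bank := nat -> nat.
Definition memory := nat -> bank.

Inductive binop :=
  Add | Monus | Mul | Div | Mod | Eq | Lt | And | Or | Xor | Shl | Shr.

Definition binop_sem (o : binop) (x y : nat) : nat :=
  match o with
  | Add => x + y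
  | Monus => x - y
  | Mul => x * y
  | Div => x %/ y
  | Mod => x %% y
  | Eq => x == y
  | Lt => x < y
  | And => Nat.land x y
  | Or => Nat.lor x y
  | Xor => Nat.lxor x y
  | Shl => x * 2 ^ y
  | Shr => x %/ 2 ^ y
  end.

Inductive expr :=
  | Cst of nat
  | Get of nat & expr
  | Op of binop & expr & expr.

Inductive prog :=
  | Skip
  | Put of nat & expr & expr
  | Seq of prog & prog
  | If of expr & prog & prog
  | While of expr & prog.

Definition fits (W x : nat) : option nat := if x <= W then Some x else None.

Fixpoint eval (W : nat) (m : memory) (e : expr) : option nat :=
  match e with
  | Cst k => fits W k
  | Get a i => obind (fun x => fits W (m a x)) (eval W m i)
  | Op o e1 e2 =>
      obind (fun x => obind (fun y => fits W (binop_sem o x y)) (eval W m e2))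
            (eval W m e1)
  end.

Definition write (m : memory) (a i x : nat) : memory :=
  fun b k => if (b == a) && (k == i) then x else m b k.

(* [exec W P m m' t]: started on [m], [P] halts on [m'] after [t] steps.  An    *)
(* assignment or a test is one step: its expressions belong to the program      *)
(* text, so they amount to a constant number of word operations.                *)
Inductive exec (W : nat) : prog -> memory -> memory -> nat -> Prop :=
  | exec_skip m : exec W Skip m m 0
  | exec_put a i e m x y :
      eval W m i = Some x -> eval W m e = Some y ->
      exec W (Put a i e) m (write m a x y) 1
  | exec_seq P Q m m1 m2 t1 t2 :
      exec W P m m1 t1 -> exec W Q m1 m2 t2 ->
      exec W (Seq P Q) m m2 (t1 + t2)
  | exec_if_true e P Q m m1 x t :
      eval W m e = Some x -> x != 0 -> exec W P m m1 t ->
      exec W (If e P Q) m m1 t.+1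
  | exec_if_false e P Q m m1 t :
      eval W m e = Some 0 -> exec W Q m m1 t ->
      exec W (If e P Q) m m1 t.+1
  | exec_while_true e P m m1 m2 x t1 t2 :
      eval W m e = Some x -> x != 0 ->
      exec W P m m1 t1 -> exec W (While e P) m1 m2 t2 ->
      exec W (While e P) m m2 (t1 + t2).+1
  | exec_while_false e P m :
      eval W m e = Some 0 -> exec W (While e P) m m 1.

Definition vec_bank (n : nat) (f : 'I_n -> nat) : bank :=
  fun k => if insub k is Some i then f i else 0.

(* Row-major: entry [(i, j)] is in cell [i * n + j].                            *)
Definition mat_bank (n : nat) (f : 'I_n -> 'I_n -> nat) : bank :=
  fun k => if (insub (k %/ n), insub (k %% n)) is (Some i, Some j)
           then f i j else 0.

Definition load (bs : seq bank) : memory := nth (fun=> 0) bs.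

Definition code (o : option nat) : nat := if o is Some x then x.+1 else 0.

Definition is_min_witness (n : nat) (A B C : 'M[bool]_n) (i1 i2 i3 : 'I_n)
    (o : option nat) : Prop :=
  let wit := fun j : 'I_n => [&& A i1 j, B i2 j & C i3 j] in
  match o with
  | Some x => exists j : 'I_n,
      [/\ x = j, wit j & forall j' : 'I_n, wit j' -> j <= j']
  | None => forall j : 'I_n, ~~ wit j
  end.

Definition mw3p_input (n : nat) (A B C : 'M[bool]_n) : memory :=
  load [:: nth 0 [:: n]; mat_bank (fun i j => A i j : nat);
           mat_bank (fun i j => B i j : nat);
           mat_bank (fun i j => C i j : nat)].

Definition mw3p_output (n : nat) (A B C : 'M[bool]_n) (m : memory) : Prop :=
  forall i1 i2 i3 : 'I_n, exists o,
    is_min_witness A B C i1 i2 i3 o /\ m 4 ((i1 * n + i2) * n + i3) = code o.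

Definition solves_mw3p_in (R : realType) (P : prog) (a : R) : Prop :=
  exists (c : nat) (K : R), forall n : nat, 0 < n ->
  forall A B C : 'M[bool]_n, exists (m : memory) (t : nat),
    [/\ exec (n.+1 ^ c) P (mw3p_input A B C) m t,
        mw3p_output A B C m
      & (t%:R <= K * n%:R `^ a)%R].

Definition mw3p_hypothesis (R : realType) : Prop :=
  forall eps : R, (0 < eps)%R ->
  ~ exists P : prog, solves_mw3p_in P (7 / 2 - eps)%R.

Definition st_path (n : nat) (e : rel 'I_n) (s v : 'I_n) (p : seq 'I_n) :
    bool :=
  [&& path e s p, uniq (s :: p) & last s p == v].

Definition path_weight (n : nat) (w : 'I_n -> nat) (s : 'I_n)
    (p : seq 'I_n) : nat := \sum_(x <- s :: p) w x.

(* [None] is the distance to a vertex that is not reachable.                    *)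
Definition is_dist (n : nat) (e : rel 'I_n) (w : 'I_n -> nat) (s v : 'I_n)
    (o : option nat) : Prop :=
  match o with
  | Some d =>
      (exists2 p, st_path e s v p & path_weight w s p = d) /\
      (forall p, st_path e s v p -> d <= path_weight w s p)
  | None => forall p, ~~ st_path e s v p
  end.

Inductive dyn_mode := Incremental | Decremental.

Inductive operation (n : nat) :=
  | Update of 'I_n & 'I_n
  | Query of 'I_n.

Definition is_query (n : nat) (o : operation n) : bool :=
  if o is Query _ then true else false.

Definition same_edge (n : nat) (u v x y : 'I_n) : bool :=
  (x == u) && (y == v) || (x == v) && (y == u).

Definition legal_update (md : dyn_mode) (n : nat) (e : rel 'I_n) (u v : 'I_n) :
    bool :=
  match md with
  | Incremental => (u != v) && ~~ e u v
  | Decremental => e u v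
  end.

Definition updated (md : dyn_mode) (n : nat) (e : rel 'I_n) (u v : 'I_n) :
    rel 'I_n :=
  fun x y => match md with
             | Incremental => e x y || same_edge u v x y
             | Decremental => e x y && ~~ same_edge u v x y
             end.

Fixpoint legal (md : dyn_mode) (n : nat) (e : rel 'I_n)
    (ops : seq (operation n)) : bool :=
  match ops with
  | [::] => true
  | Update u v :: ops' =>
      legal_update md e u v && legal md (updated md e u v) ops'
  | Query _ :: ops' => legal md e ops'
  end.

(* The three procedures share one memory, kept from one call to the next.       *)
Record dyn_alg := DynAlg {
  init_proc : prog;
  update_proc : prog;
  query_proc : prog
}.

Definition sssp_input (n : nat) (e : rel 'I_n) (w : 'I_n -> nat) (s : 'I_n) :
    memory :=
  load [:: nth 0 [:: n; nat_of_ord s]; mat_bank (fun i j => e i j : nat);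
           vec_bank w].

(* Online service of a sequence of operations, in [t] steps altogether.  The    *)
(* arguments of a call are written in cells 0 and 1 of bank 3; the answer to a  *)
(* query is read from cell 0 of bank 3.                                         *)
Inductive serves (W : nat) (md : dyn_mode) (D : dyn_alg) (n : nat)
    (w : 'I_n -> nat) (s : 'I_n) :
    rel 'I_n -> seq (operation n) -> memory -> nat -> Prop :=
  | serves_nil (e : rel 'I_n) (m : memory) : serves W md D w s e [::] m 0
  | serves_update (e : rel 'I_n) (u v : 'I_n) ops (m m' : memory) (t t' : nat) :
      exec W (update_proc D) (write (write m 3 0 u) 3 1 v) m' t ->
      serves W md D w s (updated md e u v) ops m' t' ->
      serves W md D w s e (Update u v :: ops) m (t + t')
  | serves_query (e : rel 'I_n) (v : 'I_n) ops (m m' : memory) o (t t' : nat) :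
      exec W (query_proc D) (write m 3 0 v) m' t ->
      is_dist e w s v o -> m' 3 0 = code o ->
      serves W md D w s e ops m' t' ->
      serves W md D w s e (Query v :: ops) m (t + t').

(* Total time O(n ^ a), initialisation included, for every polynomial bound     *)
(* [n.+1 ^ k] on the weights.  A legal sequence has at most n(n - 1)/2 updates, *)
(* and [n ^ 3] queries are enough to read all n distances after each of them.   *)
Definition solves_nwsssp_in (R : realType) (md : dyn_mode) (D : dyn_alg)
    (a : R) : Prop :=
  forall k : nat, exists (c : nat) (K : R), forall n : nat, 0 < n ->
  forall (e : rel 'I_n) (w : 'I_n -> nat) (s : 'I_n) (ops : seq (operation n)),
    symmetric e -> irreflexive e -> (forall v, w v <= n.+1 ^ k) ->
    legal md e ops -> count (@is_query n) ops <= n ^ 3 ->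
    exists (m : memory) (t0 t : nat),
      [/\ exec (n.+1 ^ c) (init_proc D) (sssp_input e w s) m t0,
          serves (n.+1 ^ c) md D w s e ops m t
        & ((t0 + t)%:R <= K * n%:R `^ a)%R].

(* Main.v *)
(** Minimum-Witness 3-Product on [n x n] matrices is solved by one run of a dynamic
    shortest-path structure on [8 n] nodes.  Nodes form layers [s], [X], [Z], [J],
    [H], [J'], [Y], and every node weighs so much that only paths visiting each
    layer once matter.  The edges [s - X], [Z - J] (by [B]) and [J' - Y] (by [C])
    are static.  Phase [i1] inserts, for each [j] with [A i1 j], the two edges
    [J_j - H_(j + i1) - J'_j]; then [X_i1 - Z_i2] is inserted for [i2 = 0, 1, ...],
    and after each of these insertions every [Y_i3] is queried.  Only [O(n ^ 2)]
    edges are ever inserted.  A path through the hub [H_k] and the nodes [J_j],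
    [J'_j'] uses edges of phases [k - j] and [k - j'], and the weights
    [T j], [2 T (2 n - k)], [T j'], with [T] large, make its cost decreasing in both
    phases: the cheapest paths use the current phase twice, hence have [j = j'] and
    [A i1 j], although the edges of older phases are still there.  The small summand
    [j] in the weight of [J_j] then reads off the minimum witness.  The decremental
    problem gets the same graphs in the opposite order. *)

Require Import Defs.
From mathcomp Require Import all_boot all_order all_algebra.
From mathcomp Require Import reals exp.
From mathcomp Require Import zify lra.

Set Implicit Arguments.
Unset Strict Implicit.
Unset Printing Implicit Defensive.
Import Order.TTheory GRing.Theory Num.Theory.

(** * Running programs *)

Lemma fits_mono W W' x y : W <= W' -> fits W x = Some y -> fits W' x = Some y.
Proof. by rewrite /fits => leW; case: leqP => // /leq_trans -> . Qed.

Lemma eval_mono W W' m e x :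
  W <= W' -> eval W m e = Some x -> eval W' m e = Some x.
Proof.
move=> leW; elim: e x => [k|a i IHi|o e1 IH1 e2 IH2] x /=.
- exact: fits_mono.
- by case E: (eval W m i) => [y|] //= /(fits_mono leW); rewrite (IHi _ E).
case E1: (eval W m e1) => [y1|] //=; case E2: (eval W m e2) => [y2|] //=.
by move/(fits_mono leW); rewrite (IH1 _ E1) (IH2 _ E2).
Qed.

(** * Relocating a program to higher memory banks *)

Fixpoint shift_expr (d : nat) (e : expr) : expr :=
  match e with
  | Cst k => Cst k
  | Get a i => Get (d + a) (shift_expr d i)
  | Op o e1 e2 => Op o (shift_expr d e1) (shift_expr d e2)
  end.

Fixpoint shift_prog (d : nat) (P : prog) : prog :=
  match P with
  | Skip => Skip
  | Put a i e => Put (d + a) (shift_expr d i) (shift_expr d e)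
  | Seq P1 P2 => Seq (shift_prog d P1) (shift_prog d P2)
  | If e P1 P2 => If (shift_expr d e) (shift_prog d P1) (shift_prog d P2)
  | While e P1 => While (shift_expr d e) (shift_prog d P1)
  end.

Definition embeds (d : nat) (m M : memory) : Prop :=
  forall a i, M (d + a) i = m a i.

Definition same_below (d : nat) (M M' : memory) : Prop :=
  forall a i, a < d -> M' a i = M a i.

Lemma eval_shift d W m M e :
  embeds d m M -> eval W M (shift_expr d e) = eval W m e.
Proof.
move=> emM; elim: e => //= [a i ->|o e1 -> e2 ->] //.
by case: (eval W m i) => //= x; rewrite emM.
Qed.

Lemma embeds_write d m M a i x :
  embeds d m M -> embeds d (write m a i x) (write M (d + a) i x).
Proof. by move=> emM b k; rewrite /write eqn_add2l emM. Qed.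

(** Banks are named statically, so renaming them in the text confines the run to banks [d] and above
    and keeps its step count. The data structure can thus run beside the data of the reduction,
    under a possibly larger word bound. *)
Lemma exec_shift d W W' P m m' t M :
  W <= W' -> exec W P m m' t -> embeds d m M ->
  exists M', [/\ exec W' (shift_prog d P) M M' t, embeds d m' M'
               & same_below d M M'].
Proof.
move=> leW exP; elim: exP M => {P m m' t} /=.
- by move=> m M emM; exists M; split=> //; exact: exec_skip.
- move=> a i e m x y ei ee M emM; exists (write M (d + a) x y); split.
  + by apply: exec_put; rewrite (eval_shift _ _ emM); exact: eval_mono leW _.
  + exact: embeds_write.
  + by move=> b k ltb; rewrite /write; case: eqP => //= eqb; lia.
- move=> P Q m m1 m2 t1 t2 _ IH1 _ IH2 M /IH1[M1 [ex1 em1 sb1]].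
  have [M2 [ex2 em2 sb2]] := IH2 _ em1; exists M2; split=> //.
    exact: exec_seq ex1 ex2.
  by move=> a i lta; rewrite sb2 ?sb1.
- move=> e P Q m m1 x t ee x0 _ IH M emM; have [M1 [ex1 em1 sb1]] := IH _ emM.
  exists M1; split=> //; apply: exec_if_true x0 ex1.
  by rewrite (eval_shift _ _ emM); exact: eval_mono leW ee.
- move=> e P Q m m1 t ee _ IH M emM; have [M1 [ex1 em1 sb1]] := IH _ emM.
  exists M1; split=> //; apply: exec_if_false ex1.
  by rewrite (eval_shift _ _ emM); exact: eval_mono leW ee.
- move=> e P m m1 m2 x t1 t2 ee x0 _ IH1 _ IH2 M emM.
  have [M1 [ex1 em1 sb1]] := IH1 _ emM.
  have [M2 [ex2 em2 sb2]] := IH2 _ em1; exists M2; split=> //.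
    apply: exec_while_true x0 ex1 ex2.
    by rewrite (eval_shift _ _ emM); exact: eval_mono leW ee.
  by move=> a i lta; rewrite sb2 ?sb1.
- move=> e P m ee M emM; exists M; split=> //; apply: exec_while_false.
  by rewrite (eval_shift _ _ emM); exact: eval_mono leW ee.
Qed.

(** * Size of the values of arithmetic expressions *)

Fixpoint ev (m : memory) (e : expr) : nat :=
  match e with
  | Cst k => k
  | Get a i => m a (ev m i)
  | Op o e1 e2 => binop_sem o (ev m e1) (ev m e2)
  end.

Definition arith (o : binop) : bool :=
  match o with
  | Add | Monus | Mul | Div | Mod | Eq | Lt => true
  | _ => false
  end.

Fixpoint arith_below (d : nat) (e : expr) : bool :=
  match e with
  | Cst _ => true
  | Get a i => (a < d) && arith_below d i
  | Op o e1 e2 => [&& arith o, arith_below d e1 & arith_below d e2]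
  end.

(** An exponent: with cells at most [B > 1], the value is at most [B ^ cost e]. It does not decrease
    from subexpression to expression, so the same power bounds all intermediate values and
    addresses. *)
Fixpoint cost (e : expr) : nat :=
  match e with
  | Cst k => k
  | Get _ i => (cost i).+1
  | Op _ e1 e2 => (cost e1 + cost e2).+1
  end.

Definition bounded (d B : nat) (m : memory) : Prop :=
  forall a i, a < d -> m a i <= B.

Lemma arith_bound B o x y p q :
  1 < B -> arith o -> x <= B ^ p -> y <= B ^ q ->
  binop_sem o x y <= B ^ (p + q).+1.
Proof.
move=> B1 ar xp yq; have B0 : 0 < B by lia.
have Bp : 0 < B ^ p by rewrite expn_gt0 B0.
have Bq : 0 < B ^ q by rewrite expn_gt0 B0.
have xz : x <= B ^ (p + q).+1.
  by apply: leq_trans xp _; rewrite leq_exp2l //; lia.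
have z1 (b : bool) : b <= B ^ (p + q).+1.
  by apply: leq_trans (leq_b1 b) _; rewrite expn_gt0 B0.
case: o ar => //= _; rewrite ?z1 //.
- rewrite expnS expnD; apply: leq_trans (leq_add xp yq) _.
  (* The [.+1] in the exponent absorbs the factor 2 of a sum. *)
  by apply: (@leq_trans (2 * (B ^ p * B ^ q))); [nia | rewrite leq_mul2r B1 orbT].
- by apply: leq_trans xz; exact: leq_subr.
- by rewrite expnS expnD; apply: leq_trans (leq_mul xp yq) _; nia.
- by apply: leq_trans xz; exact: leq_div.
- by apply: leq_trans xz; exact: leq_mod.
Qed.

Section Evaluation.

Variables (d B W : nat) (m : memory).
Hypotheses (B1 : 1 < B) (mB : bounded d B m).

Lemma ev_bound e : arith_below d e -> ev m e <= B ^ cost e.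
Proof.
elim: e => [k _|a i IHi|o e1 IH1 e2 IH2] /=.
- by apply: ltnW; exact: ltn_expl.
- case/andP=> lta _; apply: leq_trans (mB _ lta) _.
  by rewrite -{1}(expn1 B) leq_exp2l.
- by case/and3P=> ar /IH1 h1 /IH2 h2; exact: arith_bound.
Qed.

Lemma eval_ev e :
  arith_below d e -> B ^ cost e <= W -> eval W m e = Some (ev m e).
Proof.
have fitsE e' : arith_below d e' -> B ^ cost e' <= W ->
    fits W (ev m e') = Some (ev m e').
  by move=> /ev_bound h1 h2; rewrite /fits (leq_trans h1 h2).
elim: e => [k|a i IHi|o e1 IH1 e2 IH2] ar leW; rewrite -(fitsE _ ar leW) /=.
- by [].
- case/andP: ar => _ /IHi -> //=; apply: leq_trans leW.
  by rewrite leq_exp2l //=.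
- case/and3P: (ar) => _ a1 a2; rewrite (IH1 a1) /= ?(IH2 a2) //.
    by apply: leq_trans leW; rewrite leq_exp2l //=; lia.
  by apply: leq_trans leW; rewrite leq_exp2l //=; lia.
Qed.

End Evaluation.

(* [t] is the time spent before [P] starts, so [Q] sees the total time. *)
Definition wp (W : nat) (P : prog) (m : memory) (t : nat)
    (Q : memory -> nat -> Prop) : Prop :=
  exists m' t', exec W P m m' t' /\ Q m' (t + t').

Lemma wp_skip W m t (Q : memory -> nat -> Prop) : Q m t -> wp W Skip m t Q.
Proof. by exists m, 0; rewrite addn0; split=> //; exact: exec_skip. Qed.

Lemma wp_seq W P1 P2 m t Q :
  wp W P1 m t (fun m1 t1 => wp W P2 m1 t1 Q) -> wp W (Seq P1 P2) m t Q.
Proof.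
case=> m1 [t1 [ex1 [m2 [t2 [ex2 q]]]]]; exists m2, (t1 + t2).
by rewrite addnA; split=> //; exact: exec_seq ex1 ex2.
Qed.

Definition counter : expr := Get 5 (Cst 0).

Definition for_loop (e : expr) (P : prog) : prog :=
  Seq (Put 5 (Cst 0) (Cst 0))
      (While (Op Lt counter e)
             (Seq P (Put 5 (Cst 0) (Op Add counter (Cst 1))))).

(** * Proof rules for total correctness with running time *)

Section Rules.

Variables (B C W : nat).
Hypotheses (B1 : 1 < B) (leW : B ^ C <= W).

Definition cheap (e : expr) : bool := arith_below 6 e && (cost e <= C).

Lemma eval_cheap m e : bounded 6 B m -> cheap e -> eval W m e = Some (ev m e).
Proof.
move=> mB /andP[ar co]; apply: (eval_ev B1 mB ar).
by apply: leq_trans leW; rewrite leq_exp2l.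
Qed.

Lemma wp_put a i e m t Q :
  bounded 6 B m -> cheap i -> cheap e ->
  Q (write m a (ev m i) (ev m e)) t.+1 -> wp W (Put a i e) m t Q.
Proof.
move=> mB ci ce q; exists (write m a (ev m i) (ev m e)), 1.
by rewrite addn1; split=> //; apply: exec_put; exact: eval_cheap.
Qed.

Lemma wp_if e P1 P2 m t Q :
  bounded 6 B m -> cheap e ->
  (ev m e != 0 -> wp W P1 m t.+1 Q) -> (ev m e = 0 -> wp W P2 m t.+1 Q) ->
  wp W (If e P1 P2) m t Q.
Proof.
move=> mB ce q1 q2; have ee := eval_cheap mB ce.
case: (eqVneq (ev m e) 0) => e0.
  have [m' [t' [ex q]]] := q2 e0; exists m', t'.+1; rewrite addnS -addSn.
  by split=> //; apply: exec_if_false => //; rewrite ee e0.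
have [m' [t' [ex q]]] := q1 e0; exists m', t'.+1; rewrite addnS -addSn.
by split=> //; exact: exec_if_true ee e0 ex.
Qed.

(** [I k m t] describes the state just before the test with counter [k]. The body must end with the
    counter unchanged, and the invariant is asked for after the increment. Each pass pays one step
    for the test and one for the increment, the final test one more. Termination is by induction on
    the number of passes left. *)
Lemma wp_for (L : nat) (I : nat -> memory -> nat -> Prop) e P m t Q :
  2 < C -> bounded 6 B m -> cheap (Op Lt counter e) ->
  (forall k m t, I k m t -> [/\ m 5 0 = k, bounded 6 B m & ev m e = L]) ->
  I 0 (write m 5 0 0) t.+1 ->
  (forall k m t, k < L -> I k m t ->
     wp W P m t.+1 (fun m' t' =>
       [/\ m' 5 0 = k, bounded 6 B m' & I k.+1 (write m' 5 0 k.+1) t'.+1])) ->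
  (forall m t, I L m t -> Q m t.+1) ->
  wp W (for_loop e P) m t Q.
Proof.
move=> C1 mB ce II I0 step fin.
have cC k : k <= 1 -> cheap (Cst k) by rewrite /cheap /=; lia.
apply: wp_seq; apply: (wp_put mB); [exact: cC..|move=> /=].
suff loop l : forall k m t, k + l = L -> I k m t -> wp W
    (While (Op Lt counter e) (Seq P (Put 5 (Cst 0) (Op Add counter (Cst 1)))))
    m t Q.
  by apply: (loop L 0).
elim: l {m t mB I0} => [|l IHl] k m t kl Ik; have [mk mB eL] := II _ _ _ Ik.
  have kL : k = L by lia.
  exists m, 1; rewrite addn1; split; last by apply: fin; rewrite -kL.
  by apply: exec_while_false; rewrite (eval_cheap mB ce) /= mk eL kL ltnn.
have ltkL : k < L by lia.
have [m1 [t1 [ex1 [mk1 mB1 Ik1]]]] := step _ _ _ ltkL Ik.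
have kl1 : k.+1 + l = L by lia.
have [m2 [t2 [ex2 q]]] := IHl _ _ _ kl1 Ik1.
exists m2, ((t1 + 1) + t2).+1; split; last by have := q; congr Q; lia.
apply: exec_while_true (eval_cheap mB ce) _ _ ex2.
  by rewrite /= mk eL ltkL.
apply: exec_seq ex1 _.
have -> : k.+1 = ev m1 (Op Add counter (Cst 1)) by rewrite /= mk1 addn1.
apply: exec_put; first exact: (eval_cheap (e := Cst 0) mB1).

exact: (eval_cheap (e := Op Add counter (Cst 1)) mB1).
Qed.

End Rules.

(** * The layered graph *)

Section Gadget.

Variable n : nat.
Hypothesis n_gt0 : 0 < n.
Variables a b c : nat -> nat -> bool.

(** Time in mixed radix: phase [i], subphase [f], then two indices. Edges appear only at [k = 0],
    and in subphase 2 every [k] is also a query of [Y_k], so one step carries at most one update and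
    one query. *)
Definition step (i f j k : nat) : nat := ((i * 3 + f) * n + j) * n + k.
Definition step_i t := t %/ n %/ n %/ 3.
Definition step_f t := t %/ n %/ n %% 3.
Definition step_j t := t %/ n %% n.
Definition step_k t := t %% n.

(* Node [v] is number [v %% n] of block [v %/ n]; the blocks are [s] (node 0 only), *)
(* [X], [Z], [J], two blocks for the [2 n] hubs [H], [J'], [Y].  The edge added at *)
(* time [step i f j 0] is [J_j - H_(i + j)], [J'_j - H_(i + j)] or [X_i - Z_j]      *)
(* according to [f = 0, 1, 2].                                                      *)
Definition static_edge u v : bool :=
  [|| (u == 0) && (v %/ n == 1),
      [&& u %/ n == 2, v %/ n == 3 & b (u %% n) (v %% n)]
    | [&& u %/ n == 6, v %/ n == 7 & c (v %% n) (u %% n)]].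

(** Presence is a comparison of the insertion time with [t], which gives the whole history of the
    graph in closed form. *)
Definition pair_edge t u v : bool :=
  [&& u %/ n == 1, v %/ n == 2 & step (u %% n) 2 (v %% n) 0 < t].

(** The hub number [h] runs over two blocks, hence a subtraction instead of a remainder; the phase
    of the edge is recovered as [h - j]. *)
Definition hub_edge (q f t u v : nat) : bool :=
  let j := u %% n in let h := v - 4 * n in
  [&& u %/ n == q, 3 < v %/ n, v %/ n < 6, j <= h, h - j < n, a (h - j) j
    & step (h - j) f j 0 < t].

Definition oriented t u v : bool :=
  [|| static_edge u v, pair_edge t u v, hub_edge 3 0 t u v
    | hub_edge 6 1 t u v].

Definition adj t u v : bool := oriented t u v || oriented t v u.

Definition changes t : bool :=
  (step_k t == 0) && ((step_f t == 2) || a (step_i t) (step_j t)).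

Definition edge_src t : nat :=
  (step_f t == 0) * (3 * n + step_j t) + (step_f t == 1) * (6 * n + step_j t)
  + (step_f t == 2) * (n + step_i t).

Definition edge_dst t : nat :=
  (step_f t < 2) * (4 * n + (step_i t + step_j t))
  + (step_f t == 2) * (2 * n + step_j t).

(** Case distinctions are Boolean factors, so that [weight_expr] can copy the formula in a language
    without conditional expressions. *)
Definition weight v : nat :=
  12 * (n * (n * n))
  + ((v %/ n == 1) * (2 * (n * n) * (n - v %% n))
  + ((v %/ n == 2) * (n * (n - v %% n))
  + ((v %/ n == 3) * (2 * (n * n) * (v %% n) + v %% n)
  + ((3 < v %/ n) * (v %/ n < 6) * (4 * (n * n) * (2 * n - (v - 4 * n)))
  + (v %/ n == 6) * (2 * (n * n) * (v %% n)))))).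

(** Blocks 4 and 5 both hold hubs and form one layer. *)
Definition layer v : nat := v %/ n - (4 < v %/ n).

Lemma divnMDs q r : r < n -> (q * n + r) %/ n = q.
Proof. by move=> ltr; rewrite divnMDl // divn_small // addn0. Qed.

Lemma modnMDs q r : r < n -> (q * n + r) %% n = r.
Proof. by move=> ltr; rewrite modnMDl modn_small. Qed.

Lemma step_decode i f j k :
  f < 3 -> j < n -> k < n ->
  [/\ step_i (step i f j k) = i, step_f (step i f j k) = f,
      step_j (step i f j k) = j & step_k (step i f j k) = k].
Proof.
move=> f3 jn kn; rewrite /step_i /step_f /step_j /step_k /step.
by rewrite !divnMDs // !modnMDs //; split=> //; lia.
Qed.

Lemma step_encode t : step (step_i t) (step_f t) (step_j t) (step_k t) = t.
Proof.
rewrite /step_i /step_f /step_j /step_k /step.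
by rewrite -divn_eq -divn_eq -divn_eq.
Qed.

Lemma step_digits t : [/\ step_f t < 3, step_j t < n & step_k t < n].
Proof. by rewrite /step_f /step_j /step_k !ltn_pmod. Qed.

Lemma step_i_lt t : t < 3 * (n * (n * n)) -> step_i t < n.
Proof.
move=> tn; rewrite /step_i !ltn_divLR //; apply: leq_trans tn _.
by rewrite !mulnA; lia.
Qed.

Lemma step_lt i f j k :
  i < n -> f < 3 -> j < n -> k < n -> step i f j k < 3 * (n * (n * n)).
Proof.
move=> *; rewrite /step; have h1 : i * 3 + f < 3 * n by lia.
have h2 : (i * 3 + f) * n + j < 3 * n * n by nia.
nia.
Qed.

Lemma step_ltS i f j i' f' j' k :
  f < 3 -> f' < 3 -> j < n -> j' < n -> k < n ->
  (step i f j 0 < (step i' f' j' k).+1)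
  = ((i * 3 + f < i' * 3 + f') || (i == i') && (f == f') && (j <= j')).
Proof.
move=> f3 f3' jn jn' kn; rewrite /step ltnS.
set x := i * 3 + f; set x' := i' * 3 + f'.
have -> : (i == i') && (f == f') = (x == x') by rewrite /x /x'; lia.
case: (ltngtP x x') => [lt|gt|->] /=.
- have : x * n + n <= x' * n by nia.
  nia.
- apply/negbTE; rewrite -ltnNge.
  have : x' * n + n <= x * n by nia.
  nia.
- by rewrite addn0; apply/idP/idP; nia.
Qed.

Lemma step_ltS_eq i f j t :
  f < 3 -> j < n ->
  (step i f j 0 < t.+1) =
  (step i f j 0 < t) ||
  [&& step_k t == 0, step_i t == i, step_f t == f & step_j t == j].
Proof.
move=> f3 jn; rewrite ltnS leq_eqVlt orbC; congr (_ || _).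
apply/eqP/and4P => [<-|[/eqP k0 /eqP <- /eqP <- /eqP <-]].
  by case: (@step_decode i f j 0) => // -> -> -> ->.
by rewrite -k0 step_encode.
Qed.

(** This forces a path from [s] to [Y] to have at least six edges, and one with exactly six to climb
    one layer at each edge. *)
Lemma oriented_layer t u v : oriented t u v ->
  layer u <= 6 /\ layer v <= 6 /\
  (layer v = (layer u).+1 \/ layer u = (layer v).+1).
Proof.
have div0 : 0 %/ n = 0 by rewrite div0n.
rewrite /layer; case/or4P.
- case/or3P; first by case/andP=> /eqP -> /eqP ->; rewrite div0; lia.
    by case/and3P=> /eqP -> /eqP -> _; lia.
  by case/and3P=> /eqP -> /eqP -> _; lia.
- by case/and3P=> /eqP -> /eqP -> _; lia.
- by case/and5P=> /eqP -> ? ? _ _; lia.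
- by case/and5P=> /eqP -> ? ? _ _; lia.
Qed.

Lemma adj_layer t u v : adj t u v ->
  layer u <= 6 /\ layer v <= 6 /\
  (layer v = (layer u).+1 \/ layer u = (layer v).+1).
Proof. by case/orP=> /oriented_layer; lia. Qed.

Lemma adj_sym t u v : adj t u v = adj t v u.
Proof. exact: orbC. Qed.

Lemma adj_irr t u : adj t u u = false.
Proof. by apply/negP => /adj_layer; lia. Qed.

Lemma edge_ends_lt t : t < 3 * (n * (n * n)) ->
  edge_src t < 8 * n /\ edge_dst t < 8 * n.
Proof.
move=> /step_i_lt ilt; have [f3 jn kn] := step_digits t.
by rewrite /edge_src /edge_dst; case: (step_f t) f3 => [|[|[|]]] //= _; lia.
Qed.

Lemma node_eq (q r u : nat) : r < n ->
  (u == q * n + r) = (u %/ n == q) && (u %% n == r).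
Proof.
move=> rn; apply/eqP/andP => [->|[/eqP <- /eqP <-]].
  by rewrite divnMDs // modnMDs // !eqxx.
exact: divn_eq.
Qed.

Lemma hub_index (v : nat) :
  (3 < v %/ n) && (v %/ n < 6) = (4 * n <= v) && (v < 6 * n).
Proof. by rewrite leq_divRL // ltn_divLR. Qed.

Lemma hub_edgeS q f t u v : f < 2 -> t < 3 * (n * (n * n)) ->
  hub_edge q f t.+1 u v = hub_edge q f t u v ||
  [&& step_k t == 0, step_f t == f, a (step_i t) (step_j t),
      u == q * n + step_j t & v == 4 * n + (step_i t + step_j t)].
Proof.
move=> f2 tn; have ilt := step_i_lt tn; have [_ jn _] := step_digits t.
have un : u %% n < n by rewrite ltn_pmod.
rewrite node_eq // /hub_edge step_ltS_eq //; last by lia.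
rewrite !andb_orr; congr (_ || _); set j := u %% n; set h := v - 4 * n.
apply/idP/idP.
  case/and5P=> uq v3 v6 jh /and3P[hjn ahj /and4P[k0 /eqP i0 f0 /eqP j0]].
  rewrite k0 f0 uq i0 j0 ahj /= eqxx /=.
  by move: (hub_index v); rewrite v3 v6 /= => /esym; lia.
case/and5P=> k0 f0 ha /andP[uq /eqP j0] /eqP hv.
have := hub_index v; rewrite hv.
have -> : h = step_i t + step_j t by rewrite /h hv; lia.
rewrite -/j j0 addnK ilt ha k0 f0 uq !eqxx /=.
by lia.
Qed.

Lemma pair_edgeS t u v : t < 3 * (n * (n * n)) ->
  pair_edge t.+1 u v = pair_edge t u v ||
  [&& step_k t == 0, step_f t == 2, u == n + step_i t
    & v == 2 * n + step_j t].
Proof.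
move=> tn; have ilt := step_i_lt tn; have [_ jn _] := step_digits t.
have un : u %% n < n by rewrite ltn_pmod.
have vn : v %% n < n by rewrite ltn_pmod.
rewrite -[n in n + _]mul1n !node_eq // /pair_edge step_ltS_eq //.
rewrite !andb_orr; congr (_ || _); rewrite (eq_sym (_ %% _)).
rewrite (eq_sym (v %% _)).
by apply/idP/idP; repeat case/andP=> ?; lia.
Qed.

Lemma orientedS t u v : t < 3 * (n * (n * n)) ->
  oriented t.+1 u v =
  oriented t u v || [&& changes t, u == edge_src t & v == edge_dst t].
Proof.
move=> tn; rewrite /oriented pair_edgeS // !hub_edgeS //.
rewrite /changes /edge_src /edge_dst; have [f3 _ _] := step_digits t.
case: (step_k t == 0); last by rewrite /= !orbF.
case: (step_f t) f3 => [|[|[|]]] //= _; rewrite ?mul1n ?mul0n ?add0n ?addn0;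
  rewrite ?orbF ?andTb.
- by rewrite -!orbA; do !bool_congr; rewrite orbC.
- by rewrite !orbA.
- by rewrite -!orbA; do !bool_congr; rewrite orbC -!orbA.
Qed.

(** Read forwards this is an insertion, read backwards a deletion, so it serves both modes. *)
Lemma adjS t u v : t < 3 * (n * (n * n)) ->
  adj t.+1 u v = adj t u v ||
  changes t && ((u == edge_src t) && (v == edge_dst t)
                || (u == edge_dst t) && (v == edge_src t)).
Proof.
move=> tn; rewrite /adj !orientedS //.
by case: changes; rewrite /= ?orbF // orbACA [(v == _) && _]andbC.
Qed.

(** The ends of the edge determine its insertion time, which is [t] itself and not below [t]; no
    static edge joins the same blocks. *)
Lemma changes_fresh t : t < 3 * (n * (n * n)) -> changes t ->
  adj t (edge_src t) (edge_dst t) = false.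
Proof.
move=> tn /andP[/eqP k0 _]; have ilt := step_i_lt tn.
have [f3 jn _] := step_digits t; have te := step_encode t.
rewrite k0 in te.
rewrite /adj /oriented /static_edge /pair_edge /hub_edge /edge_src /edge_dst.
case: (step_f t) f3 te => [|[|[|]]] //= _ te;
  rewrite ?mul1n ?mul0n ?add0n ?addn0.
- have := hub_index (4 * n + (step_i t + step_j t)).
  rewrite !(@divnMDs 3 _ jn) !(@modnMDs 3 _ jn) addKn addnK te ltnn.
  by lia.
- have := hub_index (4 * n + (step_i t + step_j t)).
  rewrite !(@divnMDs 6 _ jn) !(@modnMDs 6 _ jn) addKn addnK te ltnn.
  by lia.
- have := @divnMDs 1 _ ilt; have := @modnMDs 1 _ ilt; rewrite mul1n => -> ->.
  by rewrite !divnMDs // !modnMDs // te ltnn; lia.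
Qed.

(** The weight of a seven-node path through [X_i], [Z_j] and hub edges of phase [i], less the
    witness read off at [J]. The [J] indices cancel against the hub index, which leaves
    [5 * n - 3 * i]. *)
Definition base i j : nat :=
  7 * (12 * (n * (n * n))) + 2 * (n * n) * (5 * n - 3 * i) + n * (n - j).

(* The hub term turns the weights of the two [J] nodes into the phases of the   *)
(* two hub edges, so that the newest phase is the cheapest for all three.       *)
Lemma layered_weight i j i1 j1 p1 p2 x1 x2 k :
  i < n -> j < n -> k < 2 * n -> p1 <= i -> p2 <= i ->
  (i1 < i) || (i1 == i) && (j1 <= j) -> p1 + x1 = k -> p2 + x2 = k ->
  let S := 7 * (12 * (n * (n * n))) + 2 * (n * n) * (n - i1) + n * (n - j1)
           + (2 * (n * n) * x1 + x1) + 4 * (n * n) * (2 * n - k)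
           + 2 * (n * n) * x2 in
  [/\ i1 = i, j1 = j, p1 = i & p2 = i] /\ S = base i j + x1 \/
  base i j + n <= S.
Proof.
move=> ilt jlt klt p1i p2i ij1 x1k x2k.
have i1i : i1 <= i by case/orP: ij1 => [/ltnW|/andP[/eqP ->]].
(* The indices [x1] and [x2] are traded for phases; the hub counts twice, once against each. *)
have E : 5 * n - (i1 + p1 + p2) = (n - i1) + x1 + 2 * (2 * n - k) + x2.
  rewrite -{}x2k in klt x1k *; lia.
move=> S; rewrite /base.
set G := 7 * _; set T := 2 * (n * n).
have -> : S = G + T * (5 * n - (i1 + p1 + p2)) + n * (n - j1) + x1.
  rewrite E; have -> : S = G + T * (n - i1) + n * (n - j1) + (T * x1 + x1)
                + T * (2 * (2 * n - k)) + T * x2.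
    have T2 : 4 * (n * n) = T * 2 by rewrite /T; lia.
    by rewrite /S -/G -/T T2 -mulnA.
  by rewrite !mulnDr; lia.
have hT : T = n * n + n * n by rewrite /T; lia.
clear S E; clearbody T G.
(* An older phase costs at least one extra [T = 2 n^2], enough to cover [n * (n - j) + n]. *)
case: (ltnP (i1 + p1 + p2) (3 * i)) => [lt|ge].
  right; have -> : 5 * n - (i1 + p1 + p2) =
    (5 * n - 3 * i) + (3 * i - (i1 + p1 + p2)).-1.+1 by lia.
  rewrite mulnDr mulnS.
  have h1 : n * (n - j) <= n * n by rewrite leq_mul2l leq_subr orbT.
  have h2 : n <= n * n by rewrite leq_pmull.
  move: (T * (5 * n - 3 * i)) (T * _.-1) (n * (n - j)) (n * (n - j1)) h1 h2.
  by move: (n * n) hT => *; lia.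
have [i1E p1E p2E] : [/\ i1 = i, p1 = i & p2 = i].
  by split; lia.
rewrite i1E p1E p2E; have -> : i + i + i = 3 * i by lia.
(* With all phases current, an earlier [Z] node costs at least [n] more. *)
case: (ltngtP j1 j) ij1 => [lt _|gt|-> _]; last by left; split.
  right; have -> : n - j1 = (n - j) + (j - j1).-1.+1 by lia.
  rewrite mulnDr mulnS; move: (T * _) (n * (n - j)) (n * _.-1) => *; lia.
by lia.
Qed.

(** The constant 12 is [10 + 1 + 1]: ten for the phase term, one each for [n * (n - j)] and [n], in
    units of [n ^ 3]. A path with eight nodes therefore costs at least [base i j + n]. *)
Lemma base_le i j : i < n -> base i j + n <= 8 * (12 * (n * (n * n))).
Proof.
move=> ilt; rewrite /base.
have h1 : n * (n - j) <= n * n by rewrite leq_mul2l leq_subr orbT.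
have h2 : n * n <= n * (n * n) by rewrite leq_pmull.
have h3 : n <= n * n by rewrite leq_pmull.
have h4 : 2 * (n * n) * (5 * n - 3 * i) <= 2 * (n * n) * (5 * n).
  by rewrite leq_mul2l leq_subr orbT.
have h5 : 2 * (n * n) * (5 * n) = 10 * (n * (n * n)) by nia.
lia.
Qed.

Lemma weight_le v : weight v <= 40 * (n * (n * n)).
Proof.
have r : v %% n < n by rewrite ltn_pmod.
have h2 : n * n <= n * (n * n) by rewrite leq_pmull.
have h3 : n <= n * n by rewrite leq_pmull.
have q m k : k <= m -> n * n * k <= n * n * m by rewrite leq_mul2l orbC => ->.
have t1 : n * n * (n - v %% n) <= n * n * n by apply: q; lia.
have t2 : n * n * (v %% n) <= n * n * n by apply: q; lia.
have t3 : n * n * (2 * n - (v - 4 * n)) <= n * n * (2 * n) by apply: q; lia.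
have t4 : n * (n - v %% n) <= n * n by rewrite leq_mul2l leq_subr orbT.
have E1 : n * n * n = n * (n * n) by rewrite mulnA.
have E2 : n * n * (2 * n) = 2 * (n * (n * n)) by lia.
have b1 (x : bool) y z : y <= z -> x * y <= z by case: x => /=; lia.
rewrite /weight.
have := b1 (v %/ n == 1) _ _ (_ : 2 * (n * n) * (n - v %% n) <= 2 * (n * (n * n))).
have := b1 (v %/ n == 2) _ _ t4.
have := b1 (v %/ n == 3) (2 * (n * n) * (v %% n) + v %% n) (3 * (n * (n * n))).
have := b1 ((3 < v %/ n) && (v %/ n < 6))
  (4 * (n * n) * (2 * n - (v - 4 * n))) (8 * (n * (n * n))).
have := b1 (v %/ n == 6) (2 * (n * n) * (v %% n)) (2 * (n * (n * n))).
rewrite -mulnb => B1 B2 B3 B4 B5.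
have {}B1 := B1 (ltac:(lia)).
have {}B2 := B2 (ltac:(lia)).
have {}B3 := B3 (ltac:(lia)).
have {}B5 := B5 (ltac:(lia)).
lia.
Qed.

End Gadget.

(** * Distances in the layered graph and the witnesses they encode *)

Section Distances.

Variable n : nat.
Hypothesis n_gt0 : 0 < n.
Variables a b c : nat -> nat -> bool.

Local Notation adj := (adj n a b c).
Local Notation layer := (layer n).
Local Notation weight := (weight n).
Local Notation step := (step n).
Local Notation base := (base n).

(** The layer of the lower end identifies the rule that created the edge. At layer 4 the arguments
    are swapped because hub edges are oriented towards the hub; the last case covers layer 5. *)
Lemma adj_up t u v : adj t u v -> layer v = (layer u).+1 ->
  match layer u with
  | 0 => v %/ n = 1
  | 1 => pair_edge n t u v
  | 2 => [&& u %/ n == 2, v %/ n == 3 & b (u %% n) (v %% n)]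
  | 3 => hub_edge n a 3 0 t u v
  | 4 => hub_edge n a 6 1 t v u
  | _ => [&& u %/ n == 6, v %/ n == 7 & c (v %% n) (u %% n)]
  end.
Proof.
have div0 : 0 %/ n = 0 by rewrite div0n.
have small q : (4 < q) || (q <= 4) by case: ltnP.
rewrite /adj /oriented /layer => /orP[] /or4P[] E.
- case/or3P: E.
  + by case/andP=> /eqP -> /eqP ->; rewrite div0.
  + by move=> E _; case/and3P: (E) => /eqP h _ _; move: E; rewrite h.
  + by move=> E _; case/and3P: (E) => /eqP h _ _; move: E; rewrite h.
- by move=> _; case/and3P: (E) => /eqP h _ _; move: E; rewrite h.
- by move=> _; case/and5P: (E) => /eqP h _ _ _ _; move: E; rewrite h.
- by case/and5P: E => /eqP -> q1 q2 _ _; lia.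
- case/or3P: E.
  + by case/andP=> /eqP -> /eqP ->; rewrite div0.
  + by case/and3P=> /eqP -> /eqP ->.
  + by case/and3P=> /eqP -> /eqP ->.
- by case/and3P: E => /eqP -> /eqP ->.
- by case/and5P: E => /eqP -> q1 q2 _ _; lia.
- move=> _; case/and5P: (E) => _ q1 q2 _ _.
  by have -> : u %/ n - (4 < u %/ n) = 4 by lia.
Qed.

Lemma weight_hub v : 3 < v %/ n -> v %/ n < 6 ->
  weight v = 12 * (n * (n * n)) + 4 * (n * n) * (2 * n - (v - 4 * n)).
Proof.
move=> h4 h4'; rewrite /weight h4 h4' /=.
have [-> -> -> ->] : [/\ (v %/ n == 1) = false, (v %/ n == 2) = false,
     (v %/ n == 3) = false & (v %/ n == 6) = false].
  by move: h4 h4'; clear; case: (v %/ n) => [|[|[|[|[|[|[|]]]]]]].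
by rewrite ?mul1n ?mul0n ?add0n ?addn0.
Qed.

Section Graph.

Variables (e : rel 'I_(8 * n)) (i j k : nat).
Hypotheses (ilt : i < n) (jlt : j < n) (klt : k < n).
Hypothesis eE : forall u v, e u v = adj (step i 2 j k).+1 u v.
Variables (s y : 'I_(8 * n)).
Hypotheses (s0 : s = 0 :> nat) (yE : y = 7 * n + k :> nat).

Lemma path_layer p (u : 'I_(8 * n)) :
  path e u p -> layer (last u p) <= layer u + size p.
Proof.
elim: p u => [|v p IHp] u /=; first by rewrite addn0.
by rewrite eE => /andP[/(adj_layer n_gt0) h /IHp]; lia.
Qed.

Lemma path_weight_size (p : seq 'I_(8 * n)) :
  (size p).+1 * (12 * (n * (n * n))) <= path_weight (fun v => weight v) s p.
Proof.
rewrite /path_weight -[(size p).+1]/(size (s :: p)).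
elim: (s :: p) => [|v q IHq]; first by rewrite big_nil.
by rewrite big_cons /= (mulSn (size q)) leq_add // /weight leq_addr.
Qed.

Definition witness x := [&& a i x, b j x & c k x].

(** A path with more than six edges is too heavy by [base_le]; one with exactly six visits each
    layer once, and [layered_weight] applies. The gap between [base i j + x] with [x < n] and
    [base i j + n] makes distances decodable. *)
Lemma path_weight_dichotomy p : st_path e s y p ->
  (exists x, [/\ x < n, witness x
               & path_weight (fun v => weight v) s p = base i j + x]) \/
  base i j + n <= path_weight (fun v => weight v) s p.
Proof.
case/and3P=> pp _ /eqP lst; have := path_layer pp; rewrite lst.
have ly : layer y = 6 by rewrite /layer yE divnMDs.
have ls : layer s = 0 by rewrite /layer s0 div0n.
rewrite ly ls add0n leq_eqVlt => /orP[/eqP sz|sz]; last first.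
  right; apply: leq_trans (base_le n_gt0 j ilt) _.
  by apply: leq_trans (path_weight_size p); rewrite leq_mul2r; lia.
case: p sz pp lst => [|x1 [|x2 [|x3 [|x4 [|x5 [|x6 [|]]]]]]] //= _.
rewrite !eE andbT => /and5P[e1 e2 e3 e4 /andP[e5 e6]] x6E; subst x6.
have := (adj_layer n_gt0 e1, adj_layer n_gt0 e2, adj_layer n_gt0 e3,
         adj_layer n_gt0 e4, adj_layer n_gt0 e5, adj_layer n_gt0 e6).
rewrite ly ls => -[[[[[l1 l2] l3] l4] l5] l6].
have {l6}l5' : layer x5 = 5 by lia.
have {l5}l4' : layer x4 = 4 by lia.
have {l1}l1' : layer x1 = 1 by lia.
have {l2}l2' : layer x2 = 2 by lia.
have {l3 l4}l3' : layer x3 = 3 by lia.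
have := adj_up e1; rewrite ls l1' => /(_ erefl) b1.
have := adj_up e2; rewrite l1' l2' => /(_ erefl) /and3P[_ _].
have := adj_up e3; rewrite l2' l3' => /(_ erefl) /and3P[/eqP b2 /eqP b3 B3].
have := adj_up e4; rewrite l3' l4' => /(_ erefl).
case/and5P=> _ h4 h4' j3 /and3P[p3 A3].
have := adj_up e5; rewrite l4' l5' => /(_ erefl).
case/and5P=> _ _ _ j5 /and3P[p5 A5].
have := adj_up e6; rewrite l5' ly => /(_ erefl) /and3P[/eqP b5 /eqP b6 C6].
(* Presence after the current step bounds the phase of each dynamic edge by [i], and the index of
   the [Z] node by [j] when its edge has phase [i]. *)
rewrite !step_ltS ?ltn_pmod // => q5 q3 q1.
have h2n : x4 - 4 * n < 2 * n.
  have := hub_index n_gt0 x4; rewrite h4 h4' => /esym/andP[_].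
  by clear -n_gt0; lia.
have C6' : c k (x5 %% n) by move: C6; rewrite yE modnMDs.
have p1i : x4 - 4 * n - x3 %% n <= i by clear -q3; lia.
have p2i : x4 - 4 * n - x5 %% n <= i by clear -q5; lia.
have q1' : (x1 %% n < i) || (x1 %% n == i) && (x2 %% n <= j) by clear -q1; lia.
have ws : weight s = 12 * (n * (n * n)) by rewrite /weight s0 div0n /= addn0.
have wy : weight y = 12 * (n * (n * n)) by rewrite /weight b6 /= addn0.
have w1 : weight x1 = 12 * (n * (n * n)) + 2 * (n * n) * (n - x1 %% n).
  by rewrite /weight b1 /= mul1n addn0.
have w2 : weight x2 = 12 * (n * (n * n)) + n * (n - x2 %% n).
  by rewrite /weight b2 /= mul1n add0n addn0.
have w3 : weight x3 = 12 * (n * (n * n)) + (2 * (n * n) * (x3 %% n) + x3 %% n).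
  by rewrite /weight b3 /= mul1n !add0n addn0.
have w4 := weight_hub h4 h4'.
have w5 : weight x5 = 12 * (n * (n * n)) + 2 * (n * n) * (x5 %% n).
  by rewrite /weight b5 /= !mul1n !add0n.
have := layered_weight n_gt0 ilt jlt h2n p1i p2i q1' (subnK j3) (subnK j5).
rewrite /path_weight !big_cons big_nil addn0 ws wy w1 w2 w3 w4 w5.
move: (12 * _) (2 * _ * (n - _)) (n * (n - _)) (2 * _ * (x3 %% n)) => G T1 T2 T3.
move: (4 * _ * _) (2 * _ * _) => T4 T5 /=.
have -> : G + (G + T1 + (G + T2 + (G + (T3 + x3 %% n) + (G + T4 + (G + T5 + G)))))
  = 7 * G + T1 + T2 + (T3 + x3 %% n) + T4 + T5.
  by clear; lia.
case=> [[[_ j1E p1E p2E] ->]|]; last by right.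
left; exists (x3 %% n); rewrite ltn_pmod //; split=> //.
(* Both hub edges have phase [i] at the same hub, so their [J] indices coincide, and [a], [b], [c]
   hold at one index. *)
have xE : x3 %% n = x5 %% n.
  by move: p1E p2E j3 j5; clear; lia.
by rewrite /witness -{1}p1E A3 -j1E B3 xE.
Qed.

Definition node m : 'I_(8 * n) := insubd s m.

Lemma val_node m : m < 8 * n -> node m = m :> nat.
Proof. by move=> ltm; rewrite val_insubd ltm. Qed.

(** The path is [s, X_i, Z_j, J_x, H_(i + x), J'_x, Y_k]; its hub edges belong to subphases 0 and 1,
    before any query of the phase. *)
Lemma witness_path x : x < n -> witness x ->
  exists2 p, st_path e s y p
           & path_weight (fun v => weight v) s p = base i j + x.
Proof.
move=> xlt /and3P[ax bx cx].
have h45 := hub_index n_gt0 (4 * n + (i + x)).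
have {}h45 : (3 < (4 * n + (i + x)) %/ n) && ((4 * n + (i + x)) %/ n < 6).
  by rewrite h45; lia.
have [h4 h5] := andP h45.
have [x1n x2n x3n] : [/\ 1 * n + i < 8 * n, 2 * n + j < 8 * n
  & 3 * n + x < 8 * n] by split; lia.
have [x4n x5n] : 4 * n + (i + x) < 8 * n /\ 6 * n + x < 8 * n by split; lia.
exists [:: node (1 * n + i); node (2 * n + j); node (3 * n + x);
  node (4 * n + (i + x)); node (6 * n + x); y].
  apply/and3P; split; last by rewrite /= eqxx.
    rewrite /= andbT !eE !val_node // s0 yE /adj /oriented; apply/and5P; split.
    - by rewrite /static_edge divnMDs // !eqxx.
    - by rewrite /pair_edge !divnMDs // !modnMDs // step_ltS // !eqxx leqnn !orbT.
    - by rewrite /static_edge !divnMDs // !modnMDs // bx !eqxx !orbT.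
    - rewrite /hub_edge divnMDs // modnMDs // h4 h5 addKn addnK leq_addl ilt ax.
      by rewrite step_ltS // ltn_add2l !orbT.
    - apply/andP; split; last first.
        by rewrite /static_edge !divnMDs // !modnMDs // cx !eqxx !orbT.
      rewrite /hub_edge (divnMDs n_gt0 6 xlt) (@modnMDs n 6 x xlt) h4 h5 addKn.
      by rewrite addnK leq_addl ilt ax (@step_ltS n n_gt0 i 1 x) // ltn_add2l !orbT.
  (* Node numbers increase strictly along the path, hence no repetition. *)
  rewrite -(map_inj_uniq val_inj).
  apply: (sorted_uniq ltn_trans ltnn); rewrite /= !val_node // s0 yE.
  by do ![apply/andP; split] => //; lia.
have ws : weight s = 12 * (n * (n * n)) by rewrite /weight s0 div0n /= addn0.
have wy : weight y = 12 * (n * (n * n)).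
  by rewrite /weight yE divnMDs //= addn0.
have w1 : weight (1 * n + i) = 12 * (n * (n * n)) + 2 * (n * n) * (n - i).
  by rewrite /weight divnMDs // modnMDs //= mul1n addn0.
have w2 : weight (2 * n + j) = 12 * (n * (n * n)) + n * (n - j).
  by rewrite /weight divnMDs // modnMDs //= mul1n add0n addn0.
have w3 : weight (3 * n + x) = 12 * (n * (n * n)) + (2 * (n * n) * x + x).
  by rewrite /weight divnMDs // modnMDs //= mul1n !add0n addn0.
have w4 := weight_hub h4 h5.
have w5 : weight (6 * n + x) = 12 * (n * (n * n)) + 2 * (n * n) * x.
  by rewrite /weight divnMDs // modnMDs //= !mul1n !add0n.
rewrite /path_weight !big_cons big_nil addn0 !val_node // ws wy w1 w2 w3 w4 w5.
rewrite addKn /base; have -> : 5 * n - 3 * i =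
  (n - i) + x + 2 * (2 * n - (i + x)) + x by clear -ilt xlt; lia.
have -> : 4 * (n * n) = 2 * (n * n) * 2 by clear; lia.
move: (12 * _) (2 * (n * n)) (n * (n - j)) => G T V.
rewrite !mulnDr -mulnA.
move: (T * (n - i)) (T * x) (T * _) => t1 t2 t3; clear; lia.
Qed.

Definition best_witness (o : option nat) : Prop :=
  match o with
  | Some x => [/\ x < n, witness x & forall x', x' < n -> witness x' -> x <= x']
  | None => forall x, x < n -> ~~ witness x
  end.

(** [code] shifts a distance by one, so subtracting the base leaves [x + 1 = code (Some x)]. The
    comparison factor sends distances of at least [base i j + n] to 0, and an unreachable target,
    coded 0, gives 0 by truncated subtraction. *)
Lemma distance_decodes o :
  is_dist e (fun v => weight v) s y o ->
  exists o', best_witness o' /\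
    (code o < base i j + n + 1) * (code o - base i j) = code o'.
Proof.
case: o => [d|] /= => [[[p stp pw] mind]|nop]; last first.
  exists None; split=> [x xlt|]; last by rewrite muln0.
  by apply/negP => /(witness_path xlt)[p stp _]; have := nop p; rewrite stp.
rewrite addn1 ltnS; have [[x [xlt wx pwx]]|far] := path_weight_dichotomy stp.
  exists (Some x); split; last first.
    by rewrite -pw pwx /code -addnS addKn leq_add2l xlt mul1n.
  split=> // x' x'lt /(witness_path x'lt)[p' /mind].
  by rewrite -pw pwx => h1 h2; move: h1; rewrite h2 leq_add2l.
exists None; split=> [x xlt|]; last first.
  by rewrite /code -pw ltnNge far.
apply/negP => /(witness_path xlt)[p' /mind].
rewrite -pw => h1 h2; move: h1; rewrite h2 leqNgt => /negP; apply.
by apply: leq_trans far; rewrite ltn_add2l.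
Qed.

End Graph.
End Distances.

(** * The sequence of operations *)

Section Sequence.

Variables (md : dyn_mode) (n : nat).
Hypothesis n_gt0 : 0 < n.
Variables a b c : nat -> nat -> bool.

Local Notation adj := (adj n a b c).
Local Notation edge_src := (edge_src n).
Local Notation edge_dst := (edge_dst n).
Local Notation changes := (changes n a).

Definition steps : nat := 3 * (n * (n * n)).

Definition source : 'I_(8 * n) :=
  Ordinal (leq_trans n_gt0 (leq_pmull n (isT : 0 < 8))).

Definition nd (m : nat) : 'I_(8 * n) := node source m.

(* Deletions replay the insertions backwards. *)
Definition nth_step (k : nat) : nat :=
  if md is Incremental then k else steps - (1 + k).

Definition stage (k : nat) : nat :=
  if md is Incremental then k else steps - k.

Definition update_ops (t : nat) : seq (operation (8 * n)) :=
  if changes t then [:: Update (nd (edge_src t)) (nd (edge_dst t))] else [::].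

Definition query_ops (t : nat) : seq (operation (8 * n)) :=
  if step_f n t == 2 then [:: Query (nd (7 * n + step_k n t))] else [::].

(** Insertions precede the query and deletions follow it, so in both modes the query of step [t]
    sees the graph [adj t.+1]. *)
Definition step_ops (t : nat) : seq (operation (8 * n)) :=
  if md is Incremental then update_ops t ++ query_ops t
  else query_ops t ++ update_ops t.

Fixpoint ops_from (k l : nat) : seq (operation (8 * n)) :=
  if l is l'.+1 then step_ops (nth_step k) ++ ops_from k.+1 l' else [::].

Definition after_update (e : rel 'I_(8 * n)) (t : nat) : rel 'I_(8 * n) :=
  if changes t then updated md e (nd (edge_src t)) (nd (edge_dst t)) else e.

Lemma val_nd m : m < 8 * n -> nd m = m :> nat.
Proof. exact: val_node. Qed.

Definition represents (e : rel 'I_(8 * n)) (t : nat) : Prop :=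
  forall u v : 'I_(8 * n), e u v = adj t u v.

Definition before_step t := if md is Incremental then t else t.+1.
Definition after_step t := if md is Incremental then t.+1 else t.

Lemma nth_step_lt k : k < steps -> nth_step k < steps.
Proof. by rewrite /nth_step; case: md => //; lia. Qed.

Lemma stageE k : k < steps -> stage k = before_step (nth_step k).
Proof. by rewrite /stage /before_step /nth_step; case: md => //; lia. Qed.

Lemma stageS k : k < steps -> stage k.+1 = after_step (nth_step k).
Proof. by rewrite /stage /after_step /nth_step; case: md => //; lia. Qed.

Lemma represents_updated e t : t < steps ->
  represents e (before_step t) -> represents (after_update e t) (after_step t).
Proof.
move=> ltt; have [tn hn] := edge_ends_lt n_gt0 ltt.
rewrite /represents /after_update /before_step /after_step => eE u v.
case ch: (changes t); last first.
  by rewrite eE; case: md; rewrite adjS // ch orbF.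
rewrite /updated /same_edge -!val_eqE /= !val_nd // eE.
case: md eE => eE; rewrite !adjS // ch //=.
case: (boolP ((_ && _) || _)) => [uv|_]; last by rewrite orbF andbT.
(* A deleted edge is absent from the earlier graph because its insertion at step [t] was new. *)
rewrite orbT; apply/esym; have f := changes_fresh n_gt0 b c ltt ch.
by case/orP: uv => /andP[/eqP -> /eqP ->]; rewrite // adj_sym.
Qed.

Lemma legal_changes e t : t < steps -> changes t ->
  represents e (before_step t) ->
  legal_update md e (nd (edge_src t)) (nd (edge_dst t)).
Proof.
move=> ltt ch; have [tn hn] := edge_ends_lt n_gt0 ltt.
have f := changes_fresh n_gt0 b c ltt ch.
rewrite /represents /before_step /legal_update; case: md => eE.
  rewrite eE !val_nd // f andbT; apply/eqP => /(congr1 val) /=.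
  rewrite !val_nd // => th; have := adjS n_gt0 a b c (edge_src t) (edge_dst t) ltt.
  by rewrite ch th adj_irr // !eqxx orbT.
by rewrite eE !val_nd // adjS // ch !eqxx orbT.
Qed.

Lemma legal_ops k l e : k + l = steps -> represents e (stage k) ->
  legal md e (ops_from k l).
Proof.
elim: l k e => [|l IHl] k e //= kl eE; have ltk : k < steps by lia.
have ltt := nth_step_lt ltk; rewrite stageE // in eE.
have rE := represents_updated ltt eE; rewrite -stageS // in rE.
have kl' : k.+1 + l = steps by lia.
have tl := IHl _ _ kl' rE; have lc := legal_changes ltt.
have skip e' t ops : legal md e' (query_ops t ++ ops) = legal md e' ops.
  by rewrite /query_ops; case: ifP.
have upd ops : legal md (after_update e (nth_step k)) ops ->
    legal md e (update_ops (nth_step k) ++ ops).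
  rewrite /update_ops /after_update; case ch: (changes _) => //= ->.
  by rewrite (lc e ch).
have [->|->] : step_ops (nth_step k) =
    update_ops (nth_step k) ++ query_ops (nth_step k) \/
    step_ops (nth_step k) = query_ops (nth_step k) ++ update_ops (nth_step k).
- by rewrite /step_ops; case: (md); [left|right].
- by rewrite -catA; apply: upd; rewrite skip.
- by rewrite -catA skip; apply: upd.
Qed.

Lemma count_ops k l : count (@is_query _) (ops_from k l) <= l.
Proof.
elim: l k => [|l IHl] k //=; rewrite count_cat -(add1n l) leq_add //.
have u t : count (@is_query _) (update_ops t) = 0.
  by rewrite /update_ops; case: ifP.
have q t : count (@is_query _) (query_ops t) <= 1.
  by rewrite /query_ops; case: ifP.
by rewrite /step_ops; case: md; rewrite count_cat u ?addn0 ?add0n q.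
Qed.

End Sequence.

(** * The program *)

Section Expressions.

Let dim : expr := Get 0 (Cst 0).
Let dims k : expr := Op Mul (Cst k) dim.
Let cube k : expr := Op Mul (Cst k) (Op Mul dim (Op Mul dim dim)).
(** Boolean connectives are rendered arithmetically, on values 0 and 1, to stay within [arith]. *)
Let And e f : expr := Op Mul e f.
Let Or e f : expr := Op Lt (Cst 0) (Op Add e f).
Let block u : expr := Op Div u dim.
Let offset u : expr := Op Mod u dim.
Let blockis u q : expr := Op Eq (block u) (Cst q).
Let entry x i j : expr := Op Lt (Cst 0) (Get x (Op Add (Op Mul i dim) j)).

Definition nodes_expr : expr := dims 8.
Definition cells_expr : expr := Op Mul (dims 8) (dims 8).
Definition steps_expr : expr := cube 3.

Let step_expr i f j k : expr :=
  Op Add (Op Mul (Op Add (Op Mul (Op Add (Op Mul i (Cst 3)) (Cst f)) dim) j) dim)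
    k.
Let i_expr t : expr := Op Div (Op Div (Op Div t dim) dim) (Cst 3).
Let f_expr t : expr := Op Mod (Op Div (Op Div t dim) dim) (Cst 3).
Let j_expr t : expr := Op Mod (Op Div t dim) dim.
Let k_expr t : expr := Op Mod t dim.

Let static_expr u v : expr :=
  Or (And (Op Eq u (Cst 0)) (blockis v 1))
  (Or (And (blockis u 2) (And (blockis v 3) (entry 2 (offset u) (offset v))))
      (And (blockis u 6) (And (blockis v 7) (entry 3 (offset v) (offset u))))).

Let pair_expr t u v : expr :=
  And (blockis u 1) (And (blockis v 2)
    (Op Lt (step_expr (offset u) 2 (offset v) (Cst 0)) t)).

Let hub_expr q f t u v : expr :=
  let j := offset u in let h := Op Monus v (dims 4) in
  And (blockis u q) (And (Op Lt (Cst 3) (block v)) (And (Op Lt (block v) (Cst 6))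
  (And (Op Lt j (Op Add (Cst 1) h)) (And (Op Lt (Op Monus h j) dim)
  (And (entry 1 (Op Monus h j) j)
    (Op Lt (step_expr (Op Monus h j) f j (Cst 0)) t)))))).

Let oriented_expr t u v : expr :=
  Or (static_expr u v) (Or (pair_expr t u v)
    (Or (hub_expr 3 0 t u v) (hub_expr 6 1 t u v))).

Definition adj_expr t u v : expr :=
  Or (oriented_expr t u v) (oriented_expr t v u).

Definition changes_expr t : expr :=
  And (Op Eq (k_expr t) (Cst 0))
      (Or (Op Eq (f_expr t) (Cst 2)) (entry 1 (i_expr t) (j_expr t))).

Definition src_expr t : expr :=
  Op Add (Op Add
    (Op Mul (Op Eq (f_expr t) (Cst 0)) (Op Add (dims 3) (j_expr t)))
    (Op Mul (Op Eq (f_expr t) (Cst 1)) (Op Add (dims 6) (j_expr t))))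
    (Op Mul (Op Eq (f_expr t) (Cst 2)) (Op Add dim (i_expr t))).

Definition dst_expr t : expr :=
  Op Add
    (Op Mul (Op Lt (f_expr t) (Cst 2))
      (Op Add (dims 4) (Op Add (i_expr t) (j_expr t))))
    (Op Mul (Op Eq (f_expr t) (Cst 2)) (Op Add (dims 2) (j_expr t))).

Let sq k : expr := Op Mul (Cst k) (Op Mul dim dim).

Definition weight_expr v : expr :=
  Op Add (cube 12)
  (Op Add (Op Mul (blockis v 1) (Op Mul (sq 2) (Op Monus dim (offset v))))
  (Op Add (Op Mul (blockis v 2) (Op Mul dim (Op Monus dim (offset v))))
  (Op Add (Op Mul (blockis v 3)
             (Op Add (Op Mul (sq 2) (offset v)) (offset v)))
  (Op Add (Op Mul (Op Mul (Op Lt (Cst 3) (block v)) (Op Lt (block v) (Cst 6)))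
             (Op Mul (sq 4) (Op Monus (dims 2) (Op Monus v (dims 4)))))
     (Op Mul (blockis v 6) (Op Mul (sq 2) (offset v))))))).

Definition is_query_expr t : expr := Op Eq (f_expr t) (Cst 2).
Definition target_expr t : expr := Op Add (dims 7) (k_expr t).

Definition slot_expr t : expr :=
  Op Add (Op Mul (Op Add (Op Mul (i_expr t) dim) (j_expr t)) dim) (k_expr t).

Let base_expr t : expr :=
  Op Add (Op Add (Op Mul (Cst 7) (cube 12))
    (Op Mul (sq 2) (Op Monus (dims 5) (Op Mul (Cst 3) (i_expr t)))))
    (Op Mul dim (Op Monus dim (j_expr t))).

Definition decode_expr t x : expr :=
  Op Mul (Op Lt x (Op Add (Op Add (base_expr t) dim) (Cst 1)))
         (Op Monus x (base_expr t)).

Variables (n : nat) (m : memory).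
Hypothesis m0 : m 0 0 = n.

Definition entry_of (r : bank) i j : bool := 0 < r (i * n + j).

Let a := entry_of (m 1).
Let b := entry_of (m 2).
Let c := entry_of (m 3).

Lemma ev_and e f (p q : bool) :
  ev m e = p -> ev m f = q -> ev m (And e f) = p && q.
Proof. by move=> /= -> ->; rewrite mulnb. Qed.

Lemma ev_or e f (p q : bool) :
  ev m e = p -> ev m f = q -> ev m (Or e f) = p || q.
Proof. by move=> /= -> ->; case: p q => [] []. Qed.

Lemma ev_adj t u v :
  ev m (adj_expr t u v) = adj n a b c (ev m t) (ev m u) (ev m v).
Proof.
rewrite /adj /oriented /static_edge /pair_edge /hub_edge.
by do !(apply: ev_or || apply: ev_and); rewrite /= ?m0.
Qed.

Lemma ev_changes t : ev m (changes_expr t) = changes n a (ev m t).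
Proof. by apply: ev_and; [|apply: ev_or]; rewrite /= ?m0. Qed.

Lemma ev_src t : ev m (src_expr t) = edge_src n (ev m t).
Proof. by rewrite /= !m0. Qed.

Lemma ev_dst t : ev m (dst_expr t) = edge_dst n (ev m t).
Proof. by rewrite /= !m0. Qed.

Lemma ev_weight v : ev m (weight_expr v) = weight n (ev m v).
Proof. by rewrite /= !m0. Qed.

Lemma ev_is_query t : ev m (is_query_expr t) = (step_f n (ev m t) == 2).
Proof. by rewrite /= !m0. Qed.

Lemma ev_target t : ev m (target_expr t) = 7 * n + step_k n (ev m t).
Proof. by rewrite /= !m0. Qed.

Definition slot i j k : nat := (i * n + j) * n + k.

Lemma ev_slot t : ev m (slot_expr t) =
  slot (step_i n (ev m t)) (step_j n (ev m t)) (step_k n (ev m t)).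
Proof. by rewrite /= !m0. Qed.

Lemma ev_decode t x :
  let B := base n (step_i n (ev m t)) (step_j n (ev m t)) in
  ev m (decode_expr t x) = (ev m x < B + n + 1) * (ev m x - B).
Proof. by rewrite /= !m0. Qed.

Lemma ev_nodes : ev m nodes_expr = 8 * n. Proof. by rewrite /= m0. Qed.
Lemma ev_cells : ev m cells_expr = (8 * n) * (8 * n).
Proof. by rewrite /= m0. Qed.
Lemma ev_steps : ev m steps_expr = steps n. Proof. by rewrite /= m0. Qed.

End Expressions.

Definition time_expr (md : dyn_mode) : expr :=
  if md is Incremental then counter
  else Op Monus steps_expr (Op Add (Cst 1) counter).

Definition start_expr (md : dyn_mode) : expr :=
  if md is Incremental then Cst 0 else steps_expr.

Definition fill_adj (md : dyn_mode) : prog :=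
  for_loop cells_expr
    (Put 7 counter (adj_expr (start_expr md) (Op Div counter nodes_expr)
                             (Op Mod counter nodes_expr))).

Definition fill_weights : prog :=
  for_loop nodes_expr (Put 8 counter (weight_expr counter)).

(** Bank 9 is bank 3 of the relocated data structure, which holds arguments and answers. *)
Definition do_update (t : expr) (P : prog) : prog :=
  If (changes_expr t)
    (Seq (Put 9 (Cst 0) (src_expr t)) (Seq (Put 9 (Cst 1) (dst_expr t)) P))
    Skip.

(** The answer is first copied to bank 5, since only banks below 6 are kept bounded and may occur in
    a [cheap] expression. *)
Definition do_query (t : expr) (P : prog) : prog :=
  If (is_query_expr t)
    (Seq (Put 9 (Cst 0) (target_expr t)) (Seq P
      (Seq (Put 5 (Cst 1) (Get 9 (Cst 0)))
           (Put 4 (slot_expr t) (decode_expr t (Get 5 (Cst 1)))))))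
    Skip.

Definition do_step (md : dyn_mode) (D : dyn_alg) : prog :=
  let t := time_expr md in
  let U := do_update t (shift_prog 6 (update_proc D)) in
  let Q := do_query t (shift_prog 6 (query_proc D)) in
  if md is Incremental then Seq U Q else Seq Q U.

(* Banks 0 to 3 hold the input, bank 4 the output, bank 5 the loop counter and the *)
(* last answer; bank [k] of the data structure is bank [6 + k].                     *)
Definition reduction (md : dyn_mode) (D : dyn_alg) : prog :=
  Seq (Put 6 (Cst 0) nodes_expr) (Seq (fill_adj md) (Seq fill_weights
    (Seq (shift_prog 6 (init_proc D)) (for_loop steps_expr (do_step md D))))).

(** * Correctness and running time of the program *)

Section Correctness.

Variables (md : dyn_mode) (D : dyn_alg) (n : nat).
Hypothesis n_gt0 : 0 < n.
Variables r1 r2 r3 : bank.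

Let a := entry_of n r1.
Let b := entry_of n r2.
Let c := entry_of n r3.

(** [V] is the word bound of the data structure, [W] that of the reduction, and [B] bounds the cells
    of banks 0 to 5. The exponent 2000 is at least the [cost] of the expressions evaluated by the
    reduction itself. A coded distance is at most [320 n^4 + 1]: [8 n] nodes of weight at most
    [40 n^3], and one for [code]. *)
Variables V B W : nat.
Hypotheses (leVW : V <= W) (leBW : B ^ 2000 <= W).
Hypothesis big_B : 320 * (n * n * (n * n)) + 1 <= B.

Let B_gt1 : 1 < B.
Proof. by apply: leq_trans big_B; rewrite addn1 ltnS !muln_gt0 n_gt0. Qed.

Let n4 : [/\ n <= n * n * (n * n), n * n <= n * n * (n * n)
           & n * (n * n) <= n * n * (n * n)].
Proof.
have h1 : n <= n * n by rewrite leq_pmull.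
have h2 : n * n <= n * n * (n * n) by rewrite leq_pmull ?muln_gt0 ?n_gt0.
by split=> //; [exact: leq_trans h2 | rewrite -mulnA leq_pmull].
Qed.

Record inputs (M : memory) : Prop := Inputs {
  in0 : M 0 0 = n;
  in1 : forall i, M 1 i = r1 i;
  in2 : forall i, M 2 i = r2 i;
  in3 : forall i, M 3 i = r3 i;
  inB : bounded 6 B M
}.

Lemma inputs_below M M' : inputs M -> same_below 6 M M' -> inputs M'.
Proof.
case=> h0 h1 h2 h3 hB sM; split=> [|i|i|i|z i ltz]; rewrite sM //.
exact: (hB z i ltz).
Qed.

Lemma same_below_write M x i y : 5 < x -> same_below 6 M (write M x i y).
Proof. by move=> ltx z k ltz; rewrite /write; case: eqP => //=; lia. Qed.

Lemma inputs_write M x i y :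
  inputs M -> (3 < x) && (y <= B) || (5 < x) -> inputs (write M x i y).
Proof.
move=> [h0 h1 h2 h3 hB] xy.
have ne z k : z < 4 -> write M x i y z k = M z k.
  by move=> ltz; rewrite /write; case: eqP => //=; lia.
split=> [|k|k|k|z k ltz]; [by rewrite ne..|rewrite /write].
by case: ifP => [/andP[/eqP zx _]|_]; [lia | exact: (hB z k ltz)].
Qed.

Lemma entry_of_ext r r' : r =1 r' -> entry_of n r =2 entry_of n r'.
Proof. by move=> rr' i j; rewrite /entry_of rr'. Qed.

Lemma adj_ext p q p' q' t u v x y :
  p =2 x -> q =2 y -> p' =2 q' -> adj n p q p' t u v = adj n x y q' t u v.
Proof.
move=> e1 e2 e3; rewrite /adj /oriented /static_edge /pair_edge /hub_edge.
by rewrite !e1 !e2 !e3.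
Qed.

Lemma inputs_adj M t u v : inputs M ->
  ev M (adj_expr t u v) = adj n a b c (ev M t) (ev M u) (ev M v).
Proof.
case=> h0 h1 h2 h3 _; rewrite (ev_adj h0); congr nat_of_bool.
by apply: adj_ext; exact: entry_of_ext.
Qed.

Lemma inputs_changes M t : inputs M ->
  ev M (changes_expr t) = changes n a (ev M t).
Proof.
case=> h0 h1 _ _ _; rewrite (ev_changes h0) /changes.
by rewrite (entry_of_ext (h1 : M 1 =1 r1)).
Qed.

Lemma wp_fill x eL L e f M t Q :
  5 < x -> L <= B -> cheap 2000 (Op Lt counter eL) -> cheap 2000 e ->
  (forall M, inputs M -> ev M eL = L) ->
  (forall M k, inputs M -> M 5 0 = k -> k < L -> ev M e = f k) ->
  inputs M ->
  (forall M', inputs M' ->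
     (forall z i, 5 < z -> z != x -> M' z i = M z i) ->
     (forall i, M' x i = if i < L then f i else M x i) ->
     Q M' (t + (3 * L + 2))) ->
  wp W (for_loop eL (Put x counter e)) M t Q.
Proof.
move=> ltx LB cL ce evL ef iM fin.
(* Three steps per pass (test, assignment, increment) and one for the initialisation; the final test
   makes [3 * L + 2]. *)
pose I k M' t' := [/\ inputs M', M' 5 0 = k,
  (forall z i, 5 < z -> z != x -> M' z i = M z i),
  (forall i, M' x i = if i < k then f i else M x i) & t' = t + (3 * k + 1)].
apply: (@wp_for B 2000 W B_gt1 leBW L I) => //.
- exact: inB.
- by move=> k M' t' [iM' kM' _ _ _]; split=> //; [exact: inB | exact: evL].
- split=> //; try lia.
  + by apply: inputs_write => //; lia.
  + by move=> z i ltz _; rewrite /write; case: eqP => //=; lia.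
  + by move=> i; rewrite /write; case: eqP => //=; lia.
- move=> k M' t' ltk [iM' kM' zM' xM' ->].
  apply: (wp_put B_gt1 leBW) => //; first exact: inB.
  rewrite /counter /= kM' (ef _ _ iM' kM' ltk).
  have iM1 : inputs (write M' x k (f k)) by apply: inputs_write => //; lia.
  have k5 : write M' x k (f k) 5 0 = k.
    by rewrite /write; case: eqP => //=; lia.
  split=> //; first exact: inB.
  split=> //; try lia.
  + by apply: inputs_write => //; lia.
  + move=> z i ltz zx; rewrite /write (negbTE zx) /=.
    by case: eqP => //=; [lia | rewrite zM'].
  + move=> i; rewrite /write eqxx /=.
    case: eqP => [|_] /=; first by lia.
    by rewrite xM' ltnS; case: (ltngtP i k) => // ->.
- move=> M' t' [iM' _ zM' xM' ->]; have := fin _ iM' zM' xM'.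
  by congr Q; lia.
Qed.

Lemma wp_shift P m m' M t0 t (Q : memory -> nat -> Prop) :
  exec V P m m' t -> embeds 6 m M ->
  (forall M', embeds 6 m' M' -> same_below 6 M M' -> Q M' (t0 + t)) ->
  wp W (shift_prog 6 P) M t0 Q.
Proof.
move=> ex em fin; have [M' [ex' em' sb']] := exec_shift leVW ex em.
by exists M', t; split=> //; exact: fin.
Qed.

Lemma dist_bound (e : rel 'I_(8 * n)) s y o :
  is_dist e (fun v => weight n v) s y o -> code o <= B.
Proof.
case: o => [d|] // [[p /and3P[_ up _] <-] _] /=; apply: leq_trans big_B.
rewrite addn1 ltnS /path_weight.
apply: (@leq_trans (size (s :: p) * (40 * (n * (n * n))))).
  elim: (s :: p) => [|v q IHq]; first by rewrite big_nil.
  by rewrite big_cons (mulSn (size q)) leq_add // weight_le.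
apply: (@leq_trans (8 * n * (40 * (n * (n * n))))); last by lia.
rewrite leq_mul2r; apply/orP; right.
by have := max_card (mem (s :: p)); rewrite (card_uniqP up) card_ord.
Qed.

Let src := source n_gt0.
Let w (v : 'I_(8 * n)) := weight n v.
Local Notation nd := (nd n_gt0).
Local Notation nth_step := (nth_step md n).
Local Notation stage := (stage md n).
Local Notation steps := (steps n).
Local Notation represents := (represents a b c).
Local Notation update_ops := (update_ops n_gt0 a).
Local Notation query_ops := (query_ops n_gt0).
Local Notation serves := (serves V md D w src).

(** [tD] is the time the data structure still needs. Time spent plus time still needed grows only by
    the overhead of the caller: one test and two argument writes. *)
Lemma wp_update tE M m e ops tD t0 (Q : memory -> nat -> Prop) :
  cheap 2000 (changes_expr tE) -> cheap 2000 (src_expr tE) ->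
  cheap 2000 (dst_expr tE) -> inputs M -> ev M tE < steps ->
  (forall M', same_below 6 M M' -> ev M' tE = ev M tE) ->
  embeds 6 m M -> serves e (update_ops (ev M tE) ++ ops) m tD ->
  (forall M' m' tD' t', same_below 6 M M' -> embeds 6 m' M' ->
     serves (after_update md n_gt0 a e (ev M tE)) ops m' tD' ->
     t' + tD' <= t0 + tD + 3 -> Q M' t') ->
  wp W (do_update tE (shift_prog 6 (update_proc D))) M t0 Q.
Proof.
move=> c1 c2 c3 iM lt tM em sv fin.
apply: (wp_if B_gt1 leBW (inB iM) c1); rewrite inputs_changes //.
  rewrite eqb0 negbK => ch.
  move: sv fin; rewrite /update_ops /after_update ch /= => sv fin.
  have [un vn] := edge_ends_lt n_gt0 lt.
  inversion sv as [|e1 u v ops1 m1 m2 t1 t2 ex sv2|]; subst.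
  have evs := ev_src (in0 iM) tE.
  apply: wp_seq; apply: (wp_put B_gt1 leBW (inB iM)) => //; rewrite evs /=.
  set M1 := write M _ _ _.
  have sb1 : same_below 6 M M1 by apply: same_below_write.
  have iM1 := inputs_below iM sb1.
  have evd : ev M1 (dst_expr tE) = edge_dst n (ev M tE).
    by rewrite (ev_dst (in0 iM1)) tM.
  apply: wp_seq; apply: (wp_put B_gt1 leBW (inB iM1)) => //; rewrite evd /=.
  apply: (wp_shift ex).
    rewrite !val_nd //; apply: (@embeds_write 6 _ _ 3).
    exact: (@embeds_write 6 _ _ 3).
  move=> M' em' sb'; apply: (fin _ _ t2 _ _ em' sv2); last by clear; lia.
  move=> z i ltz; rewrite sb' // -(sb1 z i ltz).
  exact: (@same_below_write M1 9).
move/eqP; rewrite eqb0 => /negbTE ch.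
move: sv fin; rewrite /update_ops /after_update ch /= => sv fin.
by apply: wp_skip; apply: (fin _ _ _ _ _ em sv); rewrite //; clear; lia.
Qed.

Definition answers (t : nat) (M : memory) : Prop :=
  step_f n t = 2 -> exists2 o,
    best_witness n a b c (step_i n t) (step_j n t) (step_k n t) o
    & M 4 (slot n (step_i n t) (step_j n t) (step_k n t)) = code o.

(** Decoding in radix [n]; it keeps later answers from overwriting those of other queries. *)
Lemma slot_inj i j k i' j' k' : j < n -> k < n -> j' < n -> k' < n ->
  slot n i j k = slot n i' j' k' -> [/\ i = i', j = j' & k = k'].
Proof.
rewrite /slot => jn kn jn' kn' E.
have kE : k = k' by have := congr1 (modn^~ n) E; rewrite !modnMDs.
have := congr1 (divn^~ n) E; rewrite !divnMDs // => {}E.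
have jE : j = j' by have := congr1 (modn^~ n) E; rewrite !modnMDs.
by split=> //; have := congr1 (divn^~ n) E; rewrite !divnMDs.
Qed.

Lemma best_witness_code i j k o :
  best_witness n a b c i j k o -> code o <= n.
Proof. by case: o => [x|] //= [? _ _]. Qed.

Lemma wp_query tE M m e ops tD t0 (Q : memory -> nat -> Prop) :
  cheap 2000 (is_query_expr tE) -> cheap 2000 (target_expr tE) ->
  cheap 2000 (slot_expr tE) -> cheap 2000 (decode_expr tE (Get 5 (Cst 1))) ->
  inputs M -> ev M tE < steps ->
  (forall M', inputs M' -> M' 5 0 = M 5 0 -> ev M' tE = ev M tE) ->
  embeds 6 m M -> represents e (ev M tE).+1 ->
  serves e (query_ops (ev M tE) ++ ops) m tD ->
  (forall M' m' tD' t', inputs M' -> M' 5 0 = M 5 0 -> embeds 6 m' M' ->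
     serves e ops m' tD' -> answers (ev M tE) M' ->
     (forall t, answers t M -> answers t M') ->
     t' + tD' <= t0 + tD + 5 -> Q M' t') ->
  wp W (do_query tE (shift_prog 6 (query_proc D))) M t0 Q.
Proof.
move=> c1 c2 c3 c4 iM lt tM em rep sv fin.
have [f3 jn kn] := step_digits n_gt0 (ev M tE); have ilt := step_i_lt n_gt0 lt.
apply: (wp_if B_gt1 leBW (inB iM) c1); rewrite (ev_is_query (in0 iM)).
  rewrite eqb0 negbK => /eqP f2.
  move: sv; rewrite /query_ops f2 eqxx /= => sv.
  inversion sv as [| |e1 v ops1 m1 m2 o t1 t2 ex dist m30 sv2]; subst.
  have yn : 7 * n + step_k n (ev M tE) < 8 * n by clear -kn; lia.
  apply: wp_seq; apply: (wp_put B_gt1 leBW (inB iM)) => //.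
  rewrite (ev_target (in0 iM)) /=; set M1 := write M _ _ _.
  have sb1 : same_below 6 M M1 by apply: same_below_write.
  apply: wp_seq; apply: (wp_shift ex).
    by rewrite val_nd //; apply: (@embeds_write 6 _ _ 3).
  move=> M2 em2 sb2; have iM2 := inputs_below (inputs_below iM sb1) sb2.
  have code_B := dist_bound dist.
  have BW : B <= W.
    by apply: leq_trans leBW; rewrite -{1}(expn1 B) leq_exp2l.
  set M3 := write M2 5 1 (code o).
  have iM3 : inputs M3 by apply: inputs_write; rewrite ?code_B.
  have ev3 : ev M3 tE = ev M tE by rewrite tM // /M3 /write /= sb2 // sb1.
  (* The copied cell lies outside the bounded banks, so [dist_bound] is what shows that its value
     fits. *)
  apply: wp_seq; exists M3, 1; split.
    have em9 : M2 9 0 = code o by rewrite (em2 3).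
    apply: exec_put; first exact: (eval_cheap (e := Cst 1) B_gt1 leBW (inB iM2)).
    by rewrite /= /fits /= em9 (leq_trans code_B BW).
  apply: (wp_put B_gt1 leBW (inB iM3)) => //.
  rewrite (ev_slot (in0 iM3)) (ev_decode (in0 iM3)) ev3.
  have -> : ev M3 (Get 5 (Cst 1)) = code o by [].
  have repE u v' : e u v' = adj n a b c
      (step n (step_i n (ev M tE)) 2 (step_j n (ev M tE)) (step_k n (ev M tE))).+1 u v'.
    by have := step_encode n (ev M tE); rewrite f2 => ->.
  have [o' [best ->]] :=
    distance_decodes n_gt0 ilt jn kn repE (erefl : src = 0 :> nat) (val_nd n_gt0 yn) dist.
  set M4 := write M3 4 _ _.
  have iM4 : inputs M4.
    apply: inputs_write => //; rewrite (leq_trans (best_witness_code best)) //.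
    by case: n4 => h _ _; clear -h big_B; lia.
  apply: (fin _ m2 t2) => //.
  - by rewrite /M4 /M3 /write /= sb2 // sb1.
  - by exists o' => //; rewrite /M4 /write !eqxx.
  (* A slot hit twice belongs to the same triple, so the new content also answers the old step. *)
  - move=> t anst ft; rewrite /M4 /write eqxx /=; case: eqP => [E|_]; last first.
      have [o2 b2 h2] := anst ft; exists o2 => //.
      by rewrite /M3 /write /= sb2 // sb1.
    have [_ jn' kn'] := step_digits n_gt0 t.
    by have [-> -> ->] := slot_inj jn' kn' jn kn E; exists o'.
  - by clear; lia.
move/eqP; rewrite eqb0 => /negbTE f2.
move: sv; rewrite /query_ops f2 /= => sv.
apply: wp_skip; apply: (fin _ _ _ _ iM _ em sv) => //.
  by move=> f2'; rewrite f2' in f2.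
by clear; lia.
Qed.

Local Notation ops_from := (ops_from md n_gt0 a).
Local Notation tE := (time_expr md).

Lemma ev_time M : inputs M -> ev M tE = nth_step (M 5 0).
Proof.
move=> iM; rewrite /nth_step /time_expr; case: (md) => //.
by rewrite -(ev_steps (in0 iM)).
Qed.

Lemma cheap_update :
  [/\ cheap 2000 (changes_expr tE), cheap 2000 (src_expr tE)
    & cheap 2000 (dst_expr tE)].
Proof. by case: (md). Qed.

Lemma cheap_query :
  [/\ cheap 2000 (is_query_expr tE), cheap 2000 (target_expr tE),
     cheap 2000 (slot_expr tE) & cheap 2000 (decode_expr tE (Get 5 (Cst 1)))].
Proof. by case: (md). Qed.

Lemma answers_below t M M' : same_below 5 M M' -> answers t M -> answers t M'.
Proof. by move=> sb h /h[o bo Mo]; exists o => //; rewrite sb. Qed.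

Lemma wp_step k M m e ops tD t0 (Q : memory -> nat -> Prop) :
  k < steps -> inputs M -> M 5 0 = k -> embeds 6 m M ->
  represents e (stage k) ->
  serves e (step_ops md n_gt0 a (nth_step k) ++ ops) m tD ->
  (forall M' m' e' tD' t', inputs M' -> M' 5 0 = k -> embeds 6 m' M' ->
     represents e' (stage k.+1) -> serves e' ops m' tD' ->
     answers (nth_step k) M' -> (forall t, answers t M -> answers t M') ->
     t' + tD' <= t0 + tD + 8 -> Q M' t') ->
  wp W (do_step md D) M t0 Q.
Proof.
move=> ltk iM Mk em; rewrite stageE // => rep sv fin.
have lt := nth_step_lt md n_gt0 ltk.
have [u1 u2 u3] := cheap_update; have [q1 q2 q3 q4] := cheap_query.
have rep' := represents_updated n_gt0 lt rep; rewrite -stageS // in rep'.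
have tk M' : inputs M' -> M' 5 0 = k -> ev M' tE = nth_step k.
  by move=> iM' M'k; rewrite ev_time // M'k.
have sbk M' M'' : M' 5 0 = k -> same_below 6 M' M'' -> M'' 5 0 = k.
  by move=> M'k sb; rewrite sb.
have stab M' : inputs M' -> M' 5 0 = k ->
    forall M'', same_below 6 M' M'' -> ev M'' tE = ev M' tE.
  move=> iM' M'k M'' sb; rewrite !tk //; first exact: inputs_below iM' sb.
  exact: sbk sb.
have stab' M' : inputs M' -> M' 5 0 = k ->
    forall M'', inputs M'' -> M'' 5 0 = M' 5 0 -> ev M'' tE = ev M' tE.
  by move=> iM' M'k M'' iM'' h; rewrite !tk // h.
have ltM M' : inputs M' -> M' 5 0 = k -> ev M' tE < steps.
  by move=> iM' M'k; rewrite tk.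
(* The modes differ only in the order of update and query; in both, the query is made on the graph
   at [(nth_step k).+1]. *)
have : let U := do_update tE (shift_prog 6 (update_proc D)) in
       let Q := do_query tE (shift_prog 6 (query_proc D)) in
    [/\ do_step md D = Seq U Q,
      step_ops md n_gt0 a (nth_step k)
      = update_ops (nth_step k) ++ query_ops (nth_step k),
      before_step md (nth_step k) = nth_step k
      & stage k.+1 = (nth_step k).+1] \/
    [/\ do_step md D = Seq Q U,
      step_ops md n_gt0 a (nth_step k)
      = query_ops (nth_step k) ++ update_ops (nth_step k),
      before_step md (nth_step k) = (nth_step k).+1
      & stage k.+1 = nth_step k].
  by rewrite stageS //; case: (md); [left|right].
case=> -[-> opsE bE sE]; rewrite {}opsE -catA in sv; rewrite {}bE in rep;
  apply: wp_seq.
- rewrite -(tk _ iM Mk) in sv.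
  apply: (wp_update u1 u2 u3 iM (ltM _ iM Mk) (stab _ iM Mk) em sv).
  move=> M1 m1 tD1 t1 sb1 em1 sv1 le1.
  have iM1 := inputs_below iM sb1; have M1k := sbk _ _ Mk sb1.
  rewrite (tk _ iM Mk) in sv1; have rep1 := rep'.
  rewrite {}sE -(tk _ iM1 M1k) in rep1; rewrite -(tk _ iM1 M1k) in sv1.
  rewrite [in after_update _ _ _ _ _](tk _ iM1 M1k) in sv1 rep1.
  apply: (wp_query q1 q2 q3 q4 iM1 (ltM _ iM1 M1k) (stab' _ iM1 M1k) em1 rep1 sv1).
  move=> M2 m2 tD2 t2 iM2 M2k em2 sv2 ans2 old2 le2.
  rewrite (tk _ iM1 M1k) in ans2.
  apply: (fin _ _ _ _ _ iM2 _ em2 rep' sv2) => //.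
  + by rewrite M2k.
  + move=> t anst; apply: old2; apply: answers_below anst.
    by move=> z i ltz; apply: sb1; rewrite ltnS ltnW.
  + by clear -le1 le2; lia.
- rewrite -(tk _ iM Mk) in sv; rewrite -(tk _ iM Mk) in rep.
  apply: (wp_query q1 q2 q3 q4 iM (ltM _ iM Mk) (stab' _ iM Mk) em rep sv).
  move=> M1 m1 tD1 t1 iM1 M1k em1 sv1 ans1 old1 le1; rewrite Mk in M1k.
  rewrite (tk _ iM Mk) in ans1 sv1; rewrite -(tk _ iM1 M1k) in sv1.
  apply: (wp_update u1 u2 u3 iM1 (ltM _ iM1 M1k) (stab _ iM1 M1k) em1 sv1).
  move=> M2 m2 tD2 t2 sb2 em2 sv2 le2.
  have iM2 := inputs_below iM1 sb2; have M2k := sbk _ _ M1k sb2.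
  have sb5 : same_below 5 M1 M2.
    by move=> z i ltz; apply: sb2; rewrite ltnS ltnW.
  rewrite (tk _ iM1 M1k) in sv2.
  apply: (fin _ _ _ _ _ iM2 M2k em2 rep' sv2) => //.
  + exact: answers_below ans1.
  + by move=> t anst; apply: (answers_below sb5); exact: old1.
  + by clear -le1 le2; lia.
Qed.

Lemma wp_main_loop M m e tD t0 (Q : memory -> nat -> Prop) :
  inputs M -> embeds 6 m M -> represents e (stage 0) ->
  serves e (ops_from 0 steps) m tD ->
  (forall M' t', (forall k, k < steps -> answers (nth_step k) M') ->
     t' <= t0 + tD + 10 * steps + 2 -> Q M' t') ->
  wp W (for_loop steps_expr (do_step md D)) M t0 Q.
Proof.
move=> iM em rep sv fin.
have stepsB : steps <= B.
  by rewrite /steps; case: n4 => _ _ h; clear -h big_B; lia.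
(* Ten per pass: three for the update, five for the query, one for the test and one for the
   increment. *)
pose I k M' t' := [/\ inputs M', M' 5 0 = k,
  forall k', k' < k -> answers (nth_step k') M' &
  exists m' e' tD', [/\ embeds 6 m' M', represents e' (stage k),
    serves e' (ops_from k (steps - k)) m' tD' &
    t' + tD' <= t0 + tD + 10 * k + 1]].
apply: (@wp_for B 2000 W B_gt1 leBW steps I) => //.
- exact: inB.
- by move=> k M' t' [iM' kM' _ _]; split; [|exact: inB|exact: ev_steps (in0 iM')].
- split=> //; first by apply: inputs_write.
  by exists m, e, tD; rewrite subn0; split=> //; clear; lia.
- move=> k M1 t1 ltk [iM1 M1k ans1 [m1 [e1 [tD1 [em1 rep1 sv1 le1]]]]].
  have skE : steps - k = (steps - k.+1).+1 by rewrite -subSn // subSS.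
  rewrite skE /= in sv1.
  apply: (wp_step ltk iM1 M1k em1 rep1 sv1).
  move=> M2 m2 e2 tD2 t2 iM2 M2k em2 rep2 sv2 ans2 old2 le2.
  have ltB : k.+1 <= B by apply: leq_trans stepsB.
  split=> //; first exact: inB.
  split=> //; first by apply: inputs_write => //; rewrite ltB.
    move=> k' ltk'; apply: (@answers_below _ M2).
      by move=> z i ltz; rewrite /write; case: eqP => //= z5; rewrite z5 in ltz.
    move: ltk'; rewrite ltnS leq_eqVlt => /orP[/eqP -> //|ltk'].
    by apply: old2; exact: ans1.
  by exists m2, e2, tD2; split=> //; clear -le1 le2; lia.
- move=> M' t' [_ _ ans [m' [e' [tD' [_ _ _ le]]]]]; apply: fin => //.
  by clear -le; lia.
Qed.

Lemma mat_bank_nat (N : nat) (f : nat -> nat -> nat) k : 0 < N ->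
  mat_bank (fun i j : 'I_N => f i j) k
  = if k < N * N then f (k %/ N) (k %% N) else 0.
Proof.
move=> N0; rewrite /mat_bank -ltn_divLR //.
case: ltnP => [lt|le]; last by rewrite insubF // ltnNge le.
by rewrite insubT insubT ?ltn_pmod.
Qed.

Lemma vec_bank_nat (N : nat) (f : nat -> nat) k :
  vec_bank (fun i : 'I_N => f i) k = if k < N then f k else 0.
Proof.
rewrite /vec_bank; case: ltnP => [lt|le]; first by rewrite insubT.
by rewrite insubF // ltnNge le.
Qed.

Definition initial_graph : rel 'I_(8 * n) := fun u v => adj n a b c (stage 0) u v.

(** Beyond the calls, writing the initial graph takes about [3 * 64 n^2] steps, the weights
    [3 * 8 n] and the main loop at most [10 * 3 n^3]; 300 leaves room for the rest. *)
Lemma wp_reduction M m t0 tD :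
  inputs M -> (forall z i, 5 < z -> M z i = 0) ->
  exec V (init_proc D) (sssp_input initial_graph w src) m t0 ->
  serves initial_graph (ops_from 0 steps) m tD ->
  wp W (reduction md D) M 0 (fun M' t' =>
    (forall k, k < steps -> answers (nth_step k) M') /\
    t' <= t0 + tD + 300 * (n * (n * n))).
Proof.
move=> iM zM ex sv; have N0 : 0 < 8 * n by clear -n_gt0; lia.
have [nB n2B n3B] : [/\ 8 * n <= B, 8 * n * (8 * n) <= B & 8 * n * (8 * n) < B].
  case: n4 => h1 h2 _; have E : 8 * n * (8 * n) = 64 * (n * n) by clear; lia.
  by rewrite E; split; clear -h1 h2 big_B; lia.
apply: wp_seq; apply: (wp_put B_gt1 leBW (inB iM)) => //.
rewrite (ev_nodes (in0 iM)) /=; set M1 := write M _ _ _.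
have sb1 : same_below 6 M M1 by apply: same_below_write.
have iM1 := inputs_below iM sb1.
have fillC : cheap 2000 (Op Lt counter cells_expr) by [].
apply: wp_seq; apply: (@wp_fill 7 cells_expr (8 * n * (8 * n)) _
  (fun k => adj n a b c (stage 0) (k %/ (8 * n)) (k %% (8 * n)))) => //.
- by case: (md).
- by move=> M' iM'; exact: ev_cells (in0 iM').
- move=> M' k iM' kM' _; rewrite inputs_adj //.
  have -> : ev M' (start_expr md) = stage 0.
    rewrite /stage /start_expr; case: (md) => //.
    by rewrite (ev_steps (in0 iM')) subn0.
  have -> : ev M' (Op Div counter nodes_expr) = k %/ (8 * n).
    by rewrite -(ev_nodes (in0 iM')) -[in RHS]kM'.
  have -> // : ev M' (Op Mod counter nodes_expr) = k %% (8 * n).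
  by rewrite -(ev_nodes (in0 iM')) -[in RHS]kM'.
move=> M2 iM2 z2 x2.
apply: wp_seq; apply: (@wp_fill 8 nodes_expr (8 * n) _ (weight n)) => //.
- by move=> M' iM'; exact: ev_nodes (in0 iM').
- by move=> M' k iM' kM' _; rewrite (ev_weight (in0 iM')) -[in RHS]kM'.
move=> M3 iM3 z3 x3.
(* Zeros outside the filled cells make the relocated banks agree with the expected input
   everywhere. *)
have em : embeds 6 (sssp_input initial_graph w src) M3.
  move=> z i; rewrite /sssp_input /load; case: z => [|[|[|z]]] /=.
  - rewrite z3 // z2 // /M1 /write /=.
    by case: i => [|[|i]] //=; rewrite zM // nth_nil.
  - rewrite z3 // x2 (@mat_bank_nat _ (fun u v => adj n a b c (stage 0) u v)) //.
    by case: ifP => // _; rewrite /M1 /write zM.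
  - rewrite x3 (vec_bank_nat _ (weight n)).
    by case: ifP => // _; rewrite z2 // /M1 /write zM.
  - by rewrite z3 // z2 // /M1 /write /= zM // nth_nil.
apply: wp_seq; apply: (wp_shift ex em) => M4 em4 sb4.
have iM4 := inputs_below iM3 sb4.
apply: (wp_main_loop iM4 em4 _ sv) => // M' t' ans le; split=> //.
apply: leq_trans le _; rewrite /steps.
have h1 : n <= n * (n * n) by rewrite leq_pmulr ?muln_gt0 ?n_gt0.
have h2 : n * n <= n * (n * n) by rewrite leq_pmull.
have E : 8 * n * (8 * n) = 64 * (n * n) by clear; lia.
have h3 : 0 < n * (n * n) by rewrite !muln_gt0 n_gt0.
by rewrite E; clear -h1 h2 h3; lia.
Qed.

End Correctness.

(** * The lower bound *)

Lemma entry_of_mat n (A : 'M[bool]_n) (i j : 'I_n) :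
  entry_of n (mat_bank (fun i j => A i j : nat)) i j = A i j.
Proof.
have n0 : 0 < n by case: n i {A j} => [[]|].
rewrite /entry_of /mat_bank divnMDs // modnMDs //.
have valE (k : 'I_n) : insub (k : nat) = Some k by exact: valK.
by rewrite !valE; case: (A i j).
Qed.

Section Reduction.

Variables (md : dyn_mode) (D : dyn_alg) (n : nat).
Hypothesis n_gt0 : 0 < n.
Variables A B C : 'M[bool]_n.

Let r1 := mat_bank (fun i j => A i j : nat).
Let r2 := mat_bank (fun i j => B i j : nat).
Let r3 := mat_bank (fun i j => C i j : nat).

Lemma answers_output M :
  (forall k, k < steps n -> answers n r1 r2 r3 (nth_step md n k) M) ->
  mw3p_output A B C M.
Proof.
move=> ans i1 i2 i3.
have [fi ff fj fk] := step_decode (n := n) n_gt0 i1 (isT : 2 < 3)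
  (ltn_ord i2) (ltn_ord i3).
set t := step n i1 2 i2 i3 in fi ff fj fk.
have lt : t < steps n by apply: step_lt.
(* Every step is executed in either mode; the reversal of the order is its own inverse. *)
have [k [ltk kt]] : exists k, k < steps n /\ nth_step md n k = t.
  rewrite /nth_step; case: (md); first by exists t.
  by exists (steps n - (1 + t)); split; clear -lt; lia.
have := ans _ ltk; rewrite /answers kt fi ff fj fk => -[] // o best ->.
exists o; split=> //; case: o best => [x|] /=; last first.
  by move=> h j; have := h _ (ltn_ord j); rewrite /witness !entry_of_mat.
case=> ltx wx minx; exists (Ordinal ltx); split=> //.
  by move: wx; rewrite /witness !(entry_of_mat _ _ (Ordinal ltx)).
by move=> j wj; apply: minx => //; rewrite /witness !entry_of_mat.
Qed.

Lemma mw3p_inputs X : n <= X -> 0 < X -> inputs n r1 r2 r3 X (mw3p_input A B C).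
Proof.
move=> nX X0.
have matX (E : 'M[bool]_n) i : mat_bank (fun i j => E i j : nat) i <= X.
  rewrite /mat_bank; case: insub => [u|] //; case: insub => [v|] //.
  exact: leq_trans (leq_b1 _) X0.
split=> // -[|[|[|[|z]]]] i _ //=; try exact: matX.
- by case: i => [|[|i]].
- by case: z {X0 nX}.
Qed.

End Reduction.

(** The factor [8 ^ a] comes from running on [8 n] nodes, and [3 <= a'] absorbs the cubic overhead.
    The absolute value guards against a negative [K]. *)
Lemma reduction_time (R : realType) (a a' K : R) (n t0 t1 t : nat) :
  0 < n -> (a <= a')%R -> (3 <= a')%R ->
  ((t0 + t1)%:R <= K * (8 * n)%:R `^ a)%R ->
  t <= t0 + t1 + 300 * (n * (n * n)) ->
  (t%:R <= (`|K| * 8 `^ a + 300) * n%:R `^ a')%R.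
Proof.
move=> n0 aa' a3 le01 let_.
have n1 : (1 <= n%:R :> R)%R by rewrite ler1n.
apply: (@le_trans _ _ ((t0 + t1)%:R + 300 * n%:R ^+ 3)%R).
  rewrite -natrX -natrM -natrD ler_nat; apply: leq_trans let_ _.
  by rewrite !expnS expn0 muln1.
rewrite [leRHS]mulrDl; apply: lerD.
  apply: (le_trans le01); rewrite natrM powRM ?ler0n // mulrA.
  apply: (@le_trans _ _ (`|K| * 8 `^ a * n%:R `^ a)%R).
    by rewrite !ler_wpM2r ?powR_ge0 // ler_norm.
  by rewrite ler_wpM2l ?mulr_ge0 ?powR_ge0 // ler_powR.
rewrite ler_wpM2l ?ler0n // -powR_mulrn ?ler0n //.
exact: ler_powR.
Qed.

(** As [n + 1 >= 2], nine factors cover the constant, at most [2 ^ 9], and four more cover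
    [n ^ 4]. *)
Lemma word_bound n : 0 < n -> 320 * (n * n * (n * n)) + 1 <= n.+1 ^ 13.
Proof.
move=> n0; rewrite (expnD _ 9 4).
have h1 : 2 ^ 9 <= n.+1 ^ 9 by rewrite leq_exp2r.
have h2 : n * n * (n * n) <= n.+1 ^ 4.
  by rewrite !expnS expn0 muln1 -mulnA !leq_mul.
have h3 : 0 < n * n * (n * n) by rewrite !muln_gt0 n0.
apply: (@leq_trans (2 ^ 9 * (n * n * (n * n)))); last exact: leq_mul.
have -> : 2 ^ 9 = 512 by [].
by lia.
Qed.

Lemma nodes_bound n : 0 < n -> (8 * n).+1 <= n.+1 ^ 4.
Proof. by move=> n0; rewrite !expnS expn0; nia. Qed.

Lemma weight_bound n v : 0 < n -> weight n v <= (8 * n).+1 ^ 3.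
Proof.
move=> n0; apply: leq_trans (weight_le n0 v) _.
by rewrite !expnS expn0 muln1; nia.
Qed.

Lemma mw3p_from_nwsssp (R : realType) (md : dyn_mode) (D : dyn_alg) (a a' : R) :
  (a <= a')%R -> (3 <= a')%R ->
  solves_nwsssp_in md D a -> solves_mw3p_in (reduction md D) a'.
Proof.
move=> aa' a3 /(_ 3)[cD [K solD]].
(* [4 * cD] turns the word bound in [8 n + 1] into one in [n + 1]; [13 * 2000] is room for the
   expressions of the reduction, with [B] taken as [n.+1 ^ 13]. *)
exists (4 * cD + 13 * 2000), (`|K| * 8 `^ a + 300)%R => n n0 A B C.
pose r1 := mat_bank (fun i j => A i j : nat).
pose r2 := mat_bank (fun i j => B i j : nat).
pose r3 := mat_bank (fun i j => C i j : nat).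
pose e0 := initial_graph md (n := n) r1 r2 r3.
pose ops := ops_from md n0 (entry_of n r1) 0 (steps n).
have N0 : 0 < 8 * n by rewrite muln_gt0.
have e0E : represents (entry_of n r1) (entry_of n r2) (entry_of n r3) e0
    (stage md n 0) by [].
have [||||| m [t0 [t1 [ex sv le]]]] :=
    solD (8 * n) N0 e0 (fun v => weight n v) (source n0) ops.
- by move=> u v; rewrite /e0 /initial_graph adj_sym.
- by move=> u; rewrite /e0 /initial_graph adj_irr.
- by move=> v; exact: weight_bound.
- exact: legal_ops.
- apply: leq_trans (count_ops _ _ _ _ _) _.
  by rewrite /steps !expnS expn0 muln1; clear -n0; nia.
have leV : (8 * n).+1 ^ cD <= n.+1 ^ (4 * cD + 13 * 2000).
  rewrite expnD expnM; apply: (@leq_trans ((n.+1 ^ 4) ^ cD)).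
    by case: (cD) => [|d] //; rewrite leq_exp2r // nodes_bound.
  by rewrite leq_pmulr // expn_gt0.
have leB : (n.+1 ^ 13) ^ 2000 <= n.+1 ^ (4 * cD + 13 * 2000).
  by rewrite -expnM leq_exp2l // leq_addl.
have nB : n <= n.+1 ^ 13.
  apply: (@leq_trans n.+1) => //; rewrite -{1}(expn1 n.+1) leq_exp2l //.
have zM z i : 5 < z -> mw3p_input A B C z i = 0.
  by case: z => [|[|[|[|[|z]]]]].
have [M [t [exM [ans leM]]]] := wp_reduction leV leB (word_bound n0)
  (mw3p_inputs A B C nB (expn_gt0 _ _)) zM ex sv.
exists M, t; split=> //; first exact: answers_output ans.
exact: reduction_time le leM.
Qed.

Lemma nwsssp_lower_bound (R : realType) (md : dyn_mode) :
  mw3p_hypothesis R -> forall eps : R, (0 < eps)%R ->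
  ~ exists D : dyn_alg, solves_nwsssp_in md D (7 / 2 - eps)%R.
Proof.
move=> hyp eps eps0 [D solD].
have h2 : (0 < 1 / 2 :> R)%R by rewrite divr_gt0.
(* For [eps > 1/2] the exponent falls below 3, where the cubic overhead dominates; the minimum keeps
   it at 3 or more. *)
apply: (hyp (Num.min eps (1 / 2))%R); first by rewrite lt_min eps0.
exists (reduction md D); apply: mw3p_from_nwsssp solD.
  by rewrite lerD2l lerN2 ge_min lexx.
have : (Num.min eps (1 / 2) <= 1 / 2)%R by rewrite ge_min lexx orbT.
by lra.
Qed.

Theorem theorem3p8 (R : realType) (mw3p : mw3p_hypothesis R) :
  (forall eps : R, (0 < eps)%R ->
     ~ exists D : dyn_alg, solves_nwsssp_in Incremental D (7 / 2 - eps)%R) /\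
  (forall eps : R, (0 < eps)%R ->
     ~ exists D : dyn_alg, solves_nwsssp_in Decremental D (7 / 2 - eps)%R).
Proof. by split; apply: nwsssp_lower_bound. Qed.
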